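(* Let $m$ be an integer. (a) For every $\lambda$-ring $R$, the map $$\tau^m_R:\mathsf W^m(R)\to\mathsf B^m(R),\qquad (a_n)_{n\in\mathbb N}\mapsto\Big(\sum_{d|n}\mathsf M^m\big(a_d,\tfrac nd\big)\Big)_{n\in\mathbb N}$$ is a ring isomorphism satisfying $\Phi^m_R=\varphi^m_R\circ\tau^m_R$. (b) The assignment $R\mapsto\tau^m_R$ is a natural isomorphism between the functors $R\mapsto\mathsf W^m(R)$ and $R\mapsto\mathsf B^m(R)$ on the category of $\lambda$-rings (with $\lambda$-ring homomorphisms).
   Context: Every $\lambda$-ring $R$ is regarded as a $\Psi$-ring with $\Psi^n=\psi^n$, its $n$th Adams operation. For $k\ge1$ let $[k]_m=1+m+\dots+m^{k-1}$. Let $F(x)$ be the free $\lambda$-ring on one generator $x$. Define $\mathsf M^m(x,n)\in\mathbb Q\otimes F(x)$ recursively by $\sum_{d|n}d[\frac nd]_m\psi^{n/d}(\mathsf M^m(x,d))=[n]_mx^n$ for all $n\ge1$; these lie in $F(x)$. For $r\in R$, $\mathsf M^m(r,n)=\pi_r(\mathsf M^m(x,n))$ where $\pi_r:F(x)\to R$ is the unique $\lambda$-ring homomorphism with $x\mapsto r$. $\mathsf W^m(R)$: the commutative ring on $R^{\mathbb N}$ with $(a_n)+(b_n)=(\mathsf S_n(a,b))$, $(a_n)(b_n)=(\mathsf P_n(a,b))$, where $\mathsf S_n,\mathsf P_n\in\mathbb Z[x_d,y_d]$ are defined by $\sum_{d|n}d[\frac nd]_m\mathsf S_d^{n/d}=\sum_{d|n}d[\frac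 nd]_m(x_d^{n/d}+y_d^{n/d})$ and $\sum_{d|n}d[\frac nd]_m\mathsf P_d^{n/d}=(1-m)(\sum_{d|n}d[\frac nd]_mx_d^{n/d})(\sum_{d|n}d[\frac nd]_my_d^{n/d})$; $\Phi^m_R(a)=(\sum_{d|n}d(1-m^{n/d})a_d^{n/d})_n$. $\mathsf B^m(R)$: the commutative ring on $R^{\mathbb N}$ with componentwise addition and multiplication $(a_n)(b_n)=(\pi_{a,b}(P_n))_n$, where $P_n\in\mathbb Z[\Psi^k(x_d),\Psi^k(y_d)]$ (the free $\Psi$-ring on $x_d,y_d$) is defined by $\sum_{d|n}d[\frac nd]_m\Psi^{n/d}(P_d)=(1-m)(\sum_{d|n}d[\frac nd]_m\Psi^{n/d}(x_d))(\sum_{d|n}d[\frac nd]_m\Psi^{n/d}(y_d))$ and $\pi_{a,b}$ is the unique $\Psi$-ring homomorphism with $x_n\mapsto a_n,y_n\mapsto b_n$; $\varphi^m_R(a)=(\sum_{d|n}d(1-m^{n/d})\psi^{n/d}(a_d))_n$. Both maps land in $R^{\mathbb N}$ with componentwise operations; both functors act on morphisms by $\alpha\mapsto f\circ\alpha$. *)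

(* Defs.v *)
From HB Require Import structures.
From mathcomp Require Import all_boot all_order all_algebra.
From Stdlib Require Import ClassicalEpsilon.
Set Implicit Arguments. Unset Strict Implicit. Unset Printing Implicit Defensive.
Import Order.TTheory GRing.Theory Num.Theory.
Local Open Scope ring_scope.

(* Integer polynomial expressions in variables of type V.  An element  *)
(* of Z[V] is represented by an expression; two expressions denote the *)
(* same polynomial iff they evaluate equally in every commutative ring *)
(* under every valuation (take the polynomial ring itself).            *)
Inductive zexpr (V : Type) : Type :=
| ZV of V
| ZC of int
| ZAdd of zexpr V & zexpr V
| ZMul of zexpr V & zexpr V.

Fixpoint zeval (V : Type) (A : comPzRingType) (v : V -> A) (p : zexpr V) : A :=
  match p with
  | ZV x => v x
  | ZC c => c%:~R
  | ZAdd p q => zeval v p + zeval v q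
  | ZMul p q => zeval v p * zeval v q
  end.

Fixpoint zrename (V W : Type) (f : V -> W) (p : zexpr V) : zexpr W :=
  match p with
  | ZV x => ZV (f x)
  | ZC c => ZC W c
  | ZAdd p q => ZAdd (zrename f p) (zrename f q)
  | ZMul p q => ZMul (zrename f p) (zrename f q)
  end.

Definition esym (A : comPzRingType) (K : nat) (y : 'I_K -> A) (i : nat) : A :=
  \sum_(S : {set 'I_K} | #|S| == i) \prod_(j in S) y j.

(* (special) lambda-rings, Grothendieck's axioms.                       *)
(* Universal polynomial P_n : coefficient of t^n in prod_{i,j}(1+x_i y_j t),*)
(* written in e_1..e_n(x), e_1..e_n(y); variable (true,i) = e_{i+1}(x), *)
(* (false,i) = e_{i+1}(y).                                              *)
Definition lam_mul_spec (n : nat) (P : zexpr (bool * 'I_n)) : Prop :=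
  forall (A : comPzRingType) (x y : 'I_n -> A),
    zeval (fun v : bool * 'I_n => esym (if v.1 then x else y) (v.2).+1) P =
    \sum_(S : {set 'I_n * 'I_n} | #|S| == n) \prod_(p in S) (x p.1 * y p.2).

(* Universal polynomial P_{m,n} : coefficient of t^m in                  *)
(* prod_{|T|=n, T in [mn]} (1 + t prod_{i in T} x_i), written in         *)
(* e_1..e_{mn}(x); variable i = e_{i+1}(x).                              *)
Definition lam_comp_spec (m n : nat) (P : zexpr 'I_(m * n)) : Prop :=
  forall (A : comPzRingType) (x : 'I_(m * n) -> A),
    zeval (fun i : 'I_(m * n) => esym x i.+1) P =
    \sum_(U : {set {set 'I_(m * n)}} | (#|U| == m) && [forall T in U, #|T| == n])
       \prod_(T in U) \prod_(i in T) x i.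

Definition is_lambda_ring (R : comPzRingType) (lam : nat -> R -> R) : Prop :=
  [/\ (forall r, lam 0%N r = 1) /\ (forall r, lam 1%N r = r),
      (forall n, (1 < n)%N -> lam n 1 = 0),
      (forall n r s, lam n (r + s) = \sum_(i < n.+1) lam i r * lam (n - i)%N s),
      (forall n (P : zexpr (bool * 'I_n)), lam_mul_spec P -> forall r s,
          lam n (r * s) =
          zeval (fun v : bool * 'I_n => lam (v.2).+1 (if v.1 then r else s)) P) &
      (forall m n (P : zexpr 'I_(m * n)), lam_comp_spec P -> forall r,
          lam m (lam n r) = zeval (fun i : 'I_(m * n) => lam i.+1 r) P)].

Definition is_lambda_hom (R S : comPzRingType) (lamR : nat -> R -> R)
  (lamS : nat -> S -> S) (f : {rmorphism R -> S}) : Prop :=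
  forall n r, f (lamR n r) = lamS n (f r).

(* Adams operations via Newton's identity:                              *)
(* psi^n = sum_{i=1}^{n-1} (-1)^(i-1) lam^i psi^(n-i) + (-1)^(n-1) n lam^n *)
Section Adams.
Variables (R : comPzRingType) (lam : nat -> R -> R) (r : R).
Fixpoint adams_seq (k : nat) : seq R :=
  if k is k'.+1 then
    let s := adams_seq k' in
    rcons s (\sum_(1 <= i < k) (-1) ^+ i.+1 * lam i r * nth 0 s (k - i).-1
             + (-1) ^+ k.+1 * k%:R * lam k r)
  else [::].
End Adams.

(* psi^n(r), for n >= 1 *)
Definition adams (R : comPzRingType) (lam : nat -> R -> R) (n : nat) (r : R) : R :=
  nth 0 (adams_seq lam r n) n.-1.

Definition qint (m : int) (k : nat) : int := \sum_(i < k) m ^+ i.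
Definition wc (m : int) (n d : nat) : int := d%:Z * qint m (n %/ d)%N.

(* Sequences in R^N (N = {1,2,...}) are functions a : nat -> R where    *)
(* a k is the component of index k+1; component d is a d.-1.            *)

(* W^m : polynomials S_n, P_n in Z[x_d, y_d]; variable (true,d) = x_d,  *)
(* (false,d) = y_d.                                                     *)
Definition WS_spec (m : int) (S : nat -> zexpr (bool * nat)) : Prop :=
  forall (A : comPzRingType) (v : bool * nat -> A) (n : nat), (0 < n)%N ->
    \sum_(1 <= d < n.+1 | (d %| n)%N) (wc m n d)%:~R * zeval v (S d) ^+ (n %/ d)%N =
    \sum_(1 <= d < n.+1 | (d %| n)%N)
       (wc m n d)%:~R * (v (true, d) ^+ (n %/ d)%N + v (false, d) ^+ (n %/ d)%N).

Definition WP_spec (m : int) (P : nat -> zexpr (bool * nat)) : Prop :=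
  forall (A : comPzRingType) (v : bool * nat -> A) (n : nat), (0 < n)%N ->
    \sum_(1 <= d < n.+1 | (d %| n)%N) (wc m n d)%:~R * zeval v (P d) ^+ (n %/ d)%N =
    (1 - m)%:~R *
      (\sum_(1 <= d < n.+1 | (d %| n)%N) (wc m n d)%:~R * v (true, d) ^+ (n %/ d)%N) *
      (\sum_(1 <= d < n.+1 | (d %| n)%N) (wc m n d)%:~R * v (false, d) ^+ (n %/ d)%N).

Definition WS_poly (m : int) : nat -> zexpr (bool * nat) :=
  epsilon (inhabits (fun _ => ZC (bool * nat) 0)) (WS_spec m).
Definition WP_poly (m : int) : nat -> zexpr (bool * nat) :=
  epsilon (inhabits (fun _ => ZC (bool * nat) 0)) (WP_spec m).

Definition Wadd (m : int) (R : comPzRingType) (a b : nat -> R) : nat -> R :=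
  fun k => zeval (fun v : bool * nat => if v.1 then a (v.2).-1 else b (v.2).-1)
                 (WS_poly m k.+1).
Definition Wmul (m : int) (R : comPzRingType) (a b : nat -> R) : nat -> R :=
  fun k => zeval (fun v : bool * nat => if v.1 then a (v.2).-1 else b (v.2).-1)
                 (WP_poly m k.+1).

Definition PhiW (m : int) (R : comPzRingType) (a : nat -> R) : nat -> R :=
  fun k => \sum_(1 <= d < k.+2 | (d %| k.+1)%N)
             (d%:Z * (1 - m ^+ (k.+1 %/ d)%N))%:~R * a d.-1 ^+ (k.+1 %/ d)%N.

(* B^m : P_n in the free Psi-ring Z[Psi^k x_d, Psi^k y_d];               *)
(* variable (true,k,d) = Psi^k(x_d), (false,k,d) = Psi^k(y_d);           *)
(* Psi^j acts by (b,k,d) |-> (b,j*k,d).                                  *)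
Definition psiv (j : nat) (v : bool * nat * nat) : bool * nat * nat :=
  (v.1.1, (j * v.1.2)%N, v.2).

Definition BP_spec (m : int) (P : nat -> zexpr (bool * nat * nat)) : Prop :=
  forall (A : comPzRingType) (v : bool * nat * nat -> A) (n : nat), (0 < n)%N ->
    \sum_(1 <= d < n.+1 | (d %| n)%N)
       (wc m n d)%:~R * zeval v (zrename (psiv (n %/ d)%N) (P d)) =
    (1 - m)%:~R *
      (\sum_(1 <= d < n.+1 | (d %| n)%N) (wc m n d)%:~R * v (true, (n %/ d)%N, d)) *
      (\sum_(1 <= d < n.+1 | (d %| n)%N) (wc m n d)%:~R * v (false, (n %/ d)%N, d)).

Definition BP_poly (m : int) : nat -> zexpr (bool * nat * nat) :=
  epsilon (inhabits (fun _ => ZC (bool * nat * nat) 0)) (BP_spec m).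

Definition Badd (R : comPzRingType) (a b : nat -> R) : nat -> R := fun k => a k + b k.
Definition Bmul (m : int) (R : comPzRingType) (lam : nat -> R -> R)
    (a b : nat -> R) : nat -> R :=
  fun k => zeval (fun v : bool * nat * nat =>
                    adams lam v.1.2 (if v.1.1 then a (v.2).-1 else b (v.2).-1))
                 (BP_poly m k.+1).

Definition phiB (m : int) (R : comPzRingType) (lam : nat -> R -> R)
    (a : nat -> R) : nat -> R :=
  fun k => \sum_(1 <= d < k.+2 | (d %| k.+1)%N)
             (d%:Z * (1 - m ^+ (k.+1 %/ d)%N))%:~R * adams lam (k.+1 %/ d)%N (a d.-1).

(* M^m(x,n) in F(x) = Z[lam^1 x, lam^2 x, ...]; variable i = lam^i x.   *)
(* The defining identity in Q (x) F(x) is stated through the lambda-ring *)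
(* homomorphisms F(x) -> Z[y_1..y_K], x |-> y_1+...+y_K (lam^i x |->    *)
(* e_i(y)), under which psi^j corresponds to y_l |-> y_l^j; these maps  *)
(* are jointly injective.                                               *)
Definition M_spec (m : int) (M : nat -> zexpr nat) : Prop :=
  forall (K : nat) (A : comPzRingType) (y : 'I_K -> A) (n : nat), (0 < n)%N ->
    \sum_(1 <= d < n.+1 | (d %| n)%N)
       (wc m n d)%:~R * zeval (fun i => esym (fun l => y l ^+ (n %/ d)%N) i) (M d) =
    (qint m n)%:~R * (\sum_(l < K) y l) ^+ n.

Definition M_poly (m : int) : nat -> zexpr nat :=
  epsilon (inhabits (fun _ => ZC nat 0)) (M_spec m).

Definition Mval (m : int) (R : comPzRingType) (lam : nat -> R -> R) (r : R) (n : nat) : R :=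
  zeval (fun i => lam i r) (M_poly m n).

Definition tau (m : int) (R : comPzRingType) (lam : nat -> R -> R)
    (a : nat -> R) : nat -> R :=
  fun k => \sum_(1 <= d < k.+2 | (d %| k.+1)%N) Mval m lam (a d.-1) (k.+1 %/ d)%N.

(* Main.v *)
(* A polynomial identity over Z holds in every commutative ring, so every identity below is checked
   on integer values only, where one can divide by n.

   Integrality: a Dwork-type criterion decides when a family (g_n) of integer polynomials has the
   form g_n = sum_(d | n) d [n/d]_m theta_(n/d)(a_d) with polynomials a_d, where theta_k is the
   k-th power, Psi^k, or psi^k. It yields S_n, P_n (both versions) and M^m(x, n) and, for m = 0 and
   powers, any polynomials with prescribed Newton power sums; the latter give the universal
   polynomials of the lambda-ring axioms and psi^k lambda^i in terms of the lambda^j.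

   In a lambda-ring, lambda^i(p(r_1, r_2, ...)) is the evaluation of p in Lambda(R) at the series
   lambda_t(r_x), and Newton's power sums are ring homomorphisms on Lambda. An identity between
   tau-values thus becomes an identity between polynomials in the lambda^i(a_d), lambda^i(b_d); over
   Z, these may be replaced by arbitrary sequences E with E_0 = 1, on which psi^k acts by
   E |-> psi_seq k E. There sum_(d | n) d [n/d]_m psi^(n/d)(tau(a)_d) = sum_(d | n) d [n/d]_m
   a_d^(n/d), whose d = n term is n tau(a)_n, and additivity and multiplicativity of tau follow by
   induction on n, simultaneously for all E. Bijectivity holds because M^m(x, 1) = x makes tau
   unitriangular. *)
Require Import Defs.
From HB Require Import structures.
From mathcomp Require Import all_boot all_order all_algebra.
From mathcomp Require Import all_field ring zify.
From Stdlib Require Import ClassicalEpsilon FunctionalExtensionality.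
Set Implicit Arguments. Unset Strict Implicit. Unset Printing Implicit Defensive.
Import GRing.Theory Num.Theory Order.TTheory.
Local Open Scope ring_scope.

(** * Integer polynomial expressions *)

(** The lambda-ring axioms for products and composites speak only of expressions that satisfy
    [lam_mul_spec] or [lam_comp_spec] in every ring; they give nothing until such expressions have
    been built. Hence integrality has to precede any statement about R. The polynomials of W^m, B^m
    and M come from [epsilon], so after existence only their specifications are known. For M this is
    an obstacle: [M_spec] tests M at elementary symmetric functions, whereas the argument evaluates
    M at arbitrary integer sequences. Roots in an algebraically closed field bridge the gap.
    Newton's identity is never solved by dividing. The factorization of 1 - E_1 t + E_2 t^2 - ...
    into factors 1 - a_d t^d turns the power sums of E into sums of d a_d^(n/d), the weights for m =
    0, so one criterion serves Witt vectors, necklace rings and symmetric functions. *)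

Fixpoint zbind (V W : Type) (f : V -> zexpr W) (p : zexpr V) : zexpr W :=
  match p with
  | ZV x => f x
  | ZC c => ZC W c
  | ZAdd p q => ZAdd (zbind f p) (zbind f q)
  | ZMul p q => ZMul (zbind f p) (zbind f q)
  end.

Lemma zeval_bind (V W : Type) (A : comPzRingType) (v : W -> A) (f : V -> zexpr W) p :
  zeval v (zbind f p) = zeval (fun x => zeval v (f x)) p.
Proof. by elim: p => //= p -> q ->. Qed.

Lemma zeval_rename (V W : Type) (A : comPzRingType) (v : W -> A) (f : V -> W) p :
  zeval v (zrename f p) = zeval (fun x => v (f x)) p.
Proof. by elim: p => //= p -> q ->. Qed.

Lemma eq_zeval (V : Type) (A : comPzRingType) (v w : V -> A) p :
  v =1 w -> zeval v p = zeval w p.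
Proof. by move=> vw; elim: p => //= p -> q ->. Qed.

Lemma rmorph_zeval (V : Type) (A B : comPzRingType) (f : {rmorphism A -> B})
    (v : V -> A) p : f (zeval v p) = zeval (fun x => f (v x)) p.
Proof.
by elim: p => //= [c | p IHp q IHq | p IHp q IHq]; rewrite ?rmorph_int ?rmorphD ?rmorphM ?IHp ?IHq.
Qed.

Fixpoint zvars (V : Type) (p : zexpr V) : seq V :=
  match p with
  | ZV x => [:: x]
  | ZC _ => [::]
  | ZAdd p q => zvars p ++ zvars q
  | ZMul p q => zvars p ++ zvars q
  end.

Lemma eq_in_zeval (V : eqType) (A : comPzRingType) (v w : V -> A) p :
  {in zvars p, v =1 w} -> zeval v p = zeval w p.
Proof.
elim: p => [x|c|p IHp q IHq|p IHp q IHq] //= vw.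
- by apply: vw; rewrite inE.
- by rewrite IHp ?IHq // => x xq; apply: vw; rewrite mem_cat xq ?orbT.
- by rewrite IHp ?IHq // => x xq; apply: vw; rewrite mem_cat xq ?orbT.
Qed.

(* [horner_morph] is only available for nonzero rings. *)
Definition nonzero_copy (B : comPzRingType) of (1 != 0 :> B) : Type := B.

Section NonzeroCopy.
Variables (B : comPzRingType) (B1 : 1 != 0 :> B).
HB.instance Definition _ := GRing.ComPzRing.on (nonzero_copy B1).
HB.instance Definition _ := GRing.PzSemiRing_isNonZero.Build (nonzero_copy B1) B1.
End NonzeroCopy.

Lemma poly_eq0_inf (A : idomainType) (q : {poly A}) :
  injective (fun n : nat => n%:R : A) -> (forall t, q.[t] = 0) -> q = 0.
Proof.
move=> injA q0; apply/eqP; apply: contraT => qn0.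
have := @max_poly_roots A q (map (fun n => n%:R) (iota 0 (size q))) qn0.
rewrite size_map size_iota ltnn; apply.
  by apply/allP => _ /mapP[n _ ->]; apply/rootP; apply: q0.
by rewrite map_inj_uniq ?iota_uniq.
Qed.

(* Given finitely many elements of a ring, a tower of polynomial rings over Z
   maps onto them, and an expression vanishing on Z vanishes on the tower
   because a polynomial over an infinite domain is determined by its values. *)
Lemma universal_domain (V : eqType) (B : comNzRingType) (b : V -> B) (s : seq V) :
  exists (A : idomainType) (v : V -> A) (f : {rmorphism A -> B}),
    [/\ injective (fun n : nat => n%:R : A),
        (forall p : zexpr V, (forall w : V -> int, zeval w p = 0) ->
           forall w : V -> A, zeval w p = 0) &
        {in s, forall x, f (v x) = b x}].
Proof.
elim: s => [|x s [A [v [f [injA vanA fv]]]]].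
  exists int, (fun=> 0), (intr : {rmorphism int -> B}); split=> // n k.
  by rewrite !natz => -[].
have cfb : commr_rmorph f (b x) by move=> a; rewrite /GRing.comm mulrC.
exists {poly A}, (fun y => if y == x then 'X else (v y)%:P), (horner_morph cfb).
split=> [n k|p p0 w|y].
- by rewrite -!polyC_natr => /polyC_inj /injA.
- apply: poly_eq0_inf => // t.
  by rewrite -[LHS]/(horner_eval t _) rmorph_zeval; apply: vanA.
- rewrite inE /=; case: eqP => [-> _|_ /= ys]; first by rewrite horner_morphX.
  by rewrite horner_morphC fv.
Qed.

Lemma zeval_int_eq_nz (V : eqType) (p q : zexpr V) :
  (forall v : V -> int, zeval v p = zeval v q) ->
  forall (A : comNzRingType) (v : V -> A), zeval v p = zeval v q.
Proof.
move=> pq B b.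
have [A [v [f [_ vanA fv]]]] := universal_domain b (zvars p ++ zvars q).
pose r := ZAdd p (ZMul (ZC V (-1)) q).
have r0 : zeval v r = 0 by apply: vanA => w; rewrite /= pq mulN1r subrr.
have fE u : {subset zvars u <= zvars p ++ zvars q} -> zeval b u = f (zeval v u).
  by move=> su; rewrite rmorph_zeval; apply: eq_in_zeval => x /su /fv.
rewrite (fE p) ?(fE q); first last.
- by move=> x xp; rewrite mem_cat xp.
- by move=> x xp; rewrite mem_cat xp orbT.
congr (f _); apply/eqP; rewrite -subr_eq0; apply/eqP.
by move: r0; rewrite /= mulN1r.
Qed.

Lemma zeval_int_eq (V : eqType) (p q : zexpr V) :
  (forall v : V -> int, zeval v p = zeval v q) ->
  forall (A : comPzRingType) (v : V -> A), zeval v p = zeval v q.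
Proof.
move=> pq B b; case: (eqVneq (1 : B) 0) => [B0|B1].
  by rewrite -[LHS]mul1r -[RHS]mul1r B0 !mul0r.
pose id_copy : B -> nonzero_copy B1 := id.
have idE u : id_copy (zeval b u) = zeval (fun x => id_copy (b x)) u.
  by elim: u => [x|c|u IHu w IHw|u IHu w IHw] //=; rewrite -IHu -IHw.
by rewrite -[LHS]/(id_copy _) -[RHS]/(id_copy _) !idE; exact: (zeval_int_eq_nz pq (A := nonzero_copy B1)).
Qed.

(** Both sides of an identity can be moved from Z to every ring without writing them as expressions:
    the existence of an expression is enough. *)
Definition pfun (V : Type) (f : forall A : comPzRingType, (V -> A) -> A) :=
  exists p : zexpr V, forall (A : comPzRingType) (v : V -> A), f A v = zeval v p.

Lemma pfun_int_eq (V : eqType) (f g : forall A : comPzRingType, (V -> A) -> A) :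
  pfun f -> pfun g -> (forall v : V -> int, f int v = g int v) ->
  forall A v, f A v = g A v.
Proof.
move=> [p fp] [q gq] fg A v; rewrite fp gq; apply: zeval_int_eq => w.
by rewrite -fp -gq.
Qed.

Section PfunClosure.
Variable V : Type.
Implicit Types f g : forall A : comPzRingType, (V -> A) -> A.

Lemma pfun_var x : @pfun V (fun A v => v x).
Proof. by exists (ZV x). Qed.

Lemma pfun_const c : @pfun V (fun A v => c%:~R).
Proof. by exists (ZC V c). Qed.

Lemma pfun0 : @pfun V (fun A v => 0).
Proof. by exists (ZC V 0). Qed.

Lemma pfun1 : @pfun V (fun A v => 1).
Proof. by exists (ZC V 1). Qed.

Lemma pfunD f g : pfun f -> pfun g -> pfun (fun A v => f A v + g A v).
Proof. by move=> [p fp] [q gq]; exists (ZAdd p q) => A v; rewrite /= fp gq. Qed.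

Lemma pfunM f g : pfun f -> pfun g -> pfun (fun A v => f A v * g A v).
Proof. by move=> [p fp] [q gq]; exists (ZMul p q) => A v; rewrite /= fp gq. Qed.

Lemma pfunX f n : pfun f -> pfun (fun A v => f A v ^+ n).
Proof.
move=> [q fq]; elim: n => [|n [p IHn]]; first exact: pfun1.
by exists (ZMul q p) => A v; rewrite exprS IHn fq.
Qed.

Lemma pfun_sum (I : Type) (r : seq I) (P : pred I)
    (F : I -> forall A : comPzRingType, (V -> A) -> A) :
  (forall i, P i -> pfun (F i)) -> pfun (fun A v => \sum_(i <- r | P i) F i A v).
Proof.
move=> pF; elim: r => [|i r IHr].
  by exists (ZC V 0) => A v; rewrite big_nil.
have [p IHp] := IHr; case Pi: (P i).
  by have [q Fq] := pF i Pi; exists (ZAdd q p) => A v; rewrite big_cons Pi IHp Fq.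
by exists p => A v; rewrite big_cons Pi IHp.
Qed.

Lemma pfun_prod (I : Type) (r : seq I) (P : pred I)
    (F : I -> forall A : comPzRingType, (V -> A) -> A) :
  (forall i, P i -> pfun (F i)) -> pfun (fun A v => \prod_(i <- r | P i) F i A v).
Proof.
move=> pF; elim: r => [|i r IHr].
  by exists (ZC V 1) => A v; rewrite big_nil.
have [p IHp] := IHr; case Pi: (P i).
  by have [q Fq] := pF i Pi; exists (ZMul q p) => A v; rewrite big_cons Pi IHp Fq.
by exists p => A v; rewrite big_cons Pi IHp.
Qed.

Lemma pfun_zeval (W : Type) (g : W -> forall A : comPzRingType, (V -> A) -> A) p :
  (forall w, pfun (g w)) -> pfun (fun A v => zeval (fun w => g w A v) p).
Proof.
move=> pg; pose e w := proj1_sig (constructive_indefinite_description _ (pg w)).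
have eP w (A : comPzRingType) (v : V -> A) : g w A v = zeval v (e w).
  by rewrite /e; case: constructive_indefinite_description.
by exists (zbind e p) => A v; rewrite zeval_bind; apply: eq_zeval => w; rewrite eP.
Qed.

End PfunClosure.

(** * Congruences between polynomials and Dwork's criterion *)

(** Course-of-values recursion for a relation. Stage n looks only at earlier entries, so the finite
    list built so far, padded with [t0], stands in for the whole sequence. *)
Lemma strong_choice (T : Type) (t0 : T) (P : nat -> (nat -> T) -> T -> Prop) :
  (forall n a b t, (forall k, (k < n)%N -> a k = b k) -> P n a t -> P n b t) ->
  (forall n a, (forall k, (k < n)%N -> P k a (a k)) -> exists t, P n a t) ->
  exists a, forall n, P n a (a n).
Proof.
move=> Pext Pex.
pose next n (a : nat -> T) := epsilon (inhabits t0) (P n a).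
pose s := fix s n := if n is k.+1 then rcons (s k) (next k (nth t0 (s k))) else [::].
have size_s n : size (s n) = n by elim: n => //= n IHn; rewrite size_rcons IHn.
pose a n := nth t0 (s n.+1) n.
have sE n k : (k < n)%N -> nth t0 (s n) k = a k.
  elim: n => // n IHn; rewrite ltnS leq_eqVlt => /orP[/eqP-> //|kn].
  by rewrite /= nth_rcons size_s kn IHn.
have aE n : a n = next n (nth t0 (s n)) by rewrite /a /= nth_rcons size_s ltnn eqxx.
exists a => n; elim/ltn_ind: n => n IHn.
have [|t Pt] := Pex n (nth t0 (s n)).
  move=> k kn; rewrite sE //; apply: Pext (IHn k kn) => j jk.
  by rewrite sE // (ltn_trans jk).
rewrite aE; apply: (@Pext n (nth t0 (s n))) => [k kn|]; first by rewrite sE.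
by apply: epsilon_spec; exists t.
Qed.

Section IntegralFunctions.
Variable V : Type.
Implicit Types (f g h : (V -> int) -> int) (N M : nat).

(* [D] singles out the polynomial functions on Z^V. The quotient in [cong] must lie in [D]:
   these are congruences between polynomials, not merely between their values. *)
Definition D f := exists p : zexpr V, forall v, f v = zeval v p.

Lemma D_var x : D (fun v => v x).
Proof. by exists (ZV x). Qed.

Lemma D_const c : D (fun=> c).
Proof. by exists (ZC V c) => v /=; rewrite intz. Qed.

Lemma D_add f g : D f -> D g -> D (fun v => f v + g v).
Proof. by move=> [p fp] [q gq]; exists (ZAdd p q) => v; rewrite fp gq. Qed.

Lemma D_mul f g : D f -> D g -> D (fun v => f v * g v).
Proof. by move=> [p fp] [q gq]; exists (ZMul p q) => v; rewrite fp gq. Qed.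

Lemma D_sub f g : D f -> D g -> D (fun v => f v - g v).
Proof.
move=> Df /(D_mul (D_const (-1))) Dg; case: (D_add Df Dg) => p pE.
by exists p => v; rewrite -pE mulN1r.
Qed.

Lemma D_exp f n : D f -> D (fun v => f v ^+ n).
Proof.
move=> [p fp]; elim: n => [|n [q fq]]; first exact: D_const.
by exists (ZMul p q) => v; rewrite exprS fp /= -fq fp.
Qed.

Lemma D_sum (I : Type) (r : seq I) (P : pred I) (G : I -> (V -> int) -> int) :
  (forall i, P i -> D (G i)) -> D (fun v => \sum_(i <- r | P i) G i v).
Proof.
move=> DG; elim: r => [|i r [p IHr]].
  by have [p pE] := D_const 0; exists p => v; rewrite big_nil -pE.
case Pi: (P i); last by exists p => v; rewrite big_cons Pi IHr.
by have [q Gq] := DG i Pi; exists (ZAdd q p) => v; rewrite big_cons Pi Gq IHr.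
Qed.

Lemma D_comp f (G : (V -> int) -> V -> int) :
  (forall x, D (fun v => G v x)) -> D f -> D (fun v => f (G v)).
Proof.
move=> DG [p fp]; pose e x := proj1_sig (constructive_indefinite_description _ (DG x)).
exists (zbind e p) => v; rewrite fp zeval_bind; apply: eq_zeval => x.
by rewrite /e; case: constructive_indefinite_description.
Qed.

Definition cong N f g := exists h, D h /\ forall v, f v = g v + N%:Z * h v.

Lemma cong_refl N f : cong N f f.
Proof. by exists (fun=> 0); split=> [|v]; [exact: D_const|rewrite mulr0 addr0]. Qed.

Lemma cong_sym N f g : cong N f g -> cong N g f.
Proof.
move=> [h [Dh hE]]; exists (fun v => 0 - h v); split; first exact: D_sub (D_const 0) Dh.
by move=> v; rewrite hE; ring.
Qed.

Lemma cong_trans N f g h : cong N f g -> cong N g h -> cong N f h.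
Proof.
move=> [a [Da aE]] [b [Db bE]]; exists (fun v => b v + a v); split; first exact: D_add.
by move=> v; rewrite aE bE; ring.
Qed.

Lemma cong_add N f f' g g' :
  cong N f f' -> cong N g g' -> cong N (fun v => f v + g v) (fun v => f' v + g' v).
Proof.
move=> [a [Da aE]] [b [Db bE]]; exists (fun v => a v + b v); split; first exact: D_add.
by move=> v; rewrite aE bE; ring.
Qed.

Lemma cong_mul N f f' g g' : D f' -> D g ->
  cong N f f' -> cong N g g' -> cong N (fun v => f v * g v) (fun v => f' v * g' v).
Proof.
move=> Df' Dg [a [Da aE]] [b [Db bE]].
exists (fun v => a v * g v + f' v * b v); split; first by apply: D_add; apply: D_mul.
by move=> v; rewrite aE bE; ring.
Qed.

Lemma cong_sum N (I : Type) (r : seq I) (P : pred I) (f g : I -> (V -> int) -> int) :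
  (forall i, P i -> cong N (f i) (g i)) ->
  cong N (fun v => \sum_(i <- r | P i) f i v) (fun v => \sum_(i <- r | P i) g i v).
Proof.
move=> fg; elim: r => [|i r [a [Da aE]]].
  exists (fun=> 0); split=> [|v]; first exact: D_const.
  by rewrite !big_nil mulr0 addr0.
case Pi: (P i); last by exists a; split=> // v; rewrite !big_cons Pi aE.
have [b [Db bE]] := fg i Pi; exists (fun v => b v + a v); split; first exact: D_add.
by move=> v; rewrite !big_cons Pi aE bE; ring.
Qed.

Lemma cong_dvd N M f g : (N %| M)%N -> cong M f g -> cong N f g.
Proof.
move=> /dvdnP[k ->] [h [Dh hE]]; exists (fun v => k%:Z * h v).
by split=> [|v]; [apply: D_mul Dh; exact: D_const | rewrite hE PoszM; ring].
Qed.

(** With u M + w N = 1, write f = u M f + w N f and replace f by N b in the first term and by M a in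
    the second; the quotient stays polynomial. *)
Lemma cong0_coprime M N f :
  coprime M N -> cong M f (fun=> 0) -> cong N f (fun=> 0) -> cong (M * N) f (fun=> 0).
Proof.
move=> cMN [a [Da aE]] [b [Db bE]].
have [u [w uw]] : exists u w : int, u * M%:Z + w * N%:Z = 1.
  have /coprimezP[[u w] /= uw] : coprimez M%:Z N%:Z by [].
  by exists u, w.
exists (fun v => u * b v + w * a v); split.
  by apply: D_add; apply: D_mul => //; exact: D_const.
move=> v; rewrite PoszM -[f v]mul1r -uw mulrDl {1}bE aE; ring.
Qed.

Lemma cong0_all_primes n f : (0 < n)%N -> D f ->
  (forall p, prime p -> (p %| n)%N -> cong (p ^ logn p n) f (fun=> 0)) ->
  cong n f (fun=> 0).
Proof.
move=> + Df; elim/ltn_ind: n => n IHn n0 fn; case: (ltngtP n 1) n0 => // [n1|->] _; last first.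
  by exists f; split=> // v; rewrite add0r mul1r.
have pp := pdiv_prime n1; set p := pdiv n in pp; have pn : (p %| n)%N := pdiv_dvd n.
have n0 := ltnW n1; have [k cpk nE] := pfactor_coprime pp n0.
have k0 : (0 < k)%N by move: n0; rewrite nE muln_gt0 => /andP[].
have v0 : (0 < logn p n)%N by rewrite logn_gt0 mem_primes pp n0 pn.
rewrite nE; apply: cong0_coprime; last exact: fn.
  by rewrite coprime_sym coprimeXl.
apply: IHn => // [|q pq qk].
  by rewrite [ltnRHS]nE -[ltnLHS]muln1 ltn_pmul2l // -{1}(expn0 p) ltn_exp2l // prime_gt1.
suff <- : logn q n = logn q k by apply: fn => //; rewrite nE dvdn_mulr.
rewrite nE lognM; [|by []|by rewrite expn_gt0 prime_gt0].
rewrite lognX (logn_prime _ pp).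
case: eqP => [qp|_]; last by rewrite /= muln0 addn0.
by move: cpk; rewrite -qp prime_coprime // qk.
Qed.

End IntegralFunctions.

(** * Divisibility of [k]_m and of the weights d [n/d]_m *)

Lemma qintM1 m k : (1 - m) * qint m k = 1 - m ^+ k.
Proof. by rewrite -(opprB m) -(opprB (m ^+ k)) mulNr /qint subrX1. Qed.

Lemma qint1 m : qint m 1 = 1.
Proof. by rewrite /qint big_ord1 expr0. Qed.

Lemma qintD m j k : qint m (j + k) = qint m j + m ^+ j * qint m k.
Proof.
rewrite /qint big_split_ord /= mulr_sumr; congr (_ + _).
by apply: eq_bigr => i _; rewrite exprD.
Qed.

Lemma qint_mul m j k : qint m (j * k) = qint (m ^+ k) j * qint m k.
Proof.
elim: j => [|j IHj]; first by rewrite mul0n /qint !big_ord0 mul0r.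
by rewrite mulSn qintD IHj -add1n qintD qint1 expr1; ring.
Qed.

Lemma qint_eq1 (p : nat) (m : int) k : (p%:Z %| m - 1)%Z -> (p%:Z %| qint m k - k%:Z)%Z.
Proof.
move=> pm; elim: k => [|k IHk]; first by rewrite /qint big_ord0 subrr dvdz0.
rewrite -addn1 qintD qint1 mulr1 PoszD.
have -> : qint m k + m ^+ k - (k%:Z + 1) = qint m k - k%:Z + (m ^+ k - 1) by ring.
by rewrite rpredD // subrX1 dvdz_mulr.
Qed.

(** One factor p at a time: [p l]_m = [p]_(m^l) [l]_m, and as m^l is 1 modulo p, [p]_(m^l) is
    congruent to p, hence to 0. *)
Lemma dvdz_qint (p s k : nat) (m : int) :
  (p%:Z %| m - 1)%Z -> ((p ^ s)%N%:Z %| qint m (p ^ s * k))%Z.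
Proof.
move=> pm; elim: s => [|s IHs]; first by rewrite expn0 dvd1z.
rewrite expnS -mulnA qint_mul PoszM dvdz_mul //.
have pm' : (p%:Z %| m ^+ (p ^ s * k) - 1)%Z by rewrite subrX1 dvdz_mulr.
by rewrite -[X in (_ %| X)%Z](subrK p%:Z) rpredD ?qint_eq1 //= dvdzz.
Qed.

Lemma dvdz_wc (p n d : nat) (m : int) : prime p -> (0 < n)%N -> (d %| n)%N ->
  (p%:Z %| m - 1)%Z -> ((p ^ logn p n)%N%:Z %| wc m n d)%Z.
Proof.
move=> pp n0 dn pm; have /dvdnP[k nE] := dn.
have [k0 d0] : (0 < k)%N /\ (0 < d)%N by apply/andP; rewrite -muln_gt0 -nE.
have -> : wc m n d = d%:Z * qint m k by rewrite /wc nE mulnK.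
rewrite nE lognM // expnD mulnC PoszM dvdz_mul //.
  exact: pfactor_dvdnn.
by have /dvdnP[j kE] := pfactor_dvdnn p k; rewrite [X in qint _ X]kE mulnC dvdz_qint.
Qed.

Section Congruences.
Variable V : Type.
Implicit Types (f g h : (V -> int) -> int) (N M : nat).

Lemma D_cong N f g : D g -> cong N f g -> D f.
Proof.
move=> Dg [h [Dh fE]]; have [p pE] := D_add Dg (D_mul (D_const V N%:Z) Dh).
by exists p => v; rewrite fE pE.
Qed.

Lemma cong_exp N f g n : D g -> cong N f g ->
  cong N (fun v => f v ^+ n) (fun v => g v ^+ n).
Proof.
move=> Dg fg; have Df := D_cong Dg fg.
elim: n => [|n IHn]; first exact: cong_refl.
have [h [Dh hE]] := cong_mul Dg (D_exp n Df) fg IHn.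
by exists h; split=> // v; rewrite !exprS hE.
Qed.

(** In the binomial expansion the linear term gains its p from C(p, 1); from the quadratic term on,
    p^(2r) is already a multiple of p^(r+1), since r > 0. *)
Lemma cong_expp (p r : nat) f g : prime p -> (0 < r)%N -> D g -> cong (p ^ r) f g ->
  cong (p ^ r.+1) (fun v => f v ^+ p) (fun v => g v ^+ p).
Proof.
move=> pp r0 Dg [h [Dh fE]].
pose c i := ('C(p, i) * p ^ (r * i) %/ p ^ r.+1)%N.
have cE i : (0 < i)%N -> ('C(p, i) * p ^ (r * i) = p ^ r.+1 * c i)%N.
  move=> i0; rewrite [RHS]mulnC divnK //; case: i i0 => [|[|i]] // _.
    by rewrite bin1 muln1 expnS.
  by rewrite dvdn_mull // dvdn_exp2l // mulnS -addn1 leq_add // muln_gt0 r0.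
exists (fun v => \sum_(i < p) (c i.+1)%:Z * (g v ^+ (p - i.+1) * h v ^+ i.+1)).
split; first by apply: D_sum => i _; apply: D_mul; [exact: D_const|apply: D_mul; exact: D_exp].
move=> v; rewrite fE exprDn big_ord_recl subn0 bin0 expr0 mulr1 mulr1n; congr (_ + _).
rewrite mulr_sumr; apply: eq_bigr => i _; rewrite lift0.
rewrite exprMn [RHS]mulrA -PoszM -cE // PoszM -mulr_natl natz.
have -> : (p ^ (r * i.+1))%N%:Z = (p ^ r)%N%:Z ^+ i.+1 by rewrite expnM -!natz natrX.
ring.
Qed.

Lemma cong_exp_pow (p r s : nat) f g : prime p -> (0 < r)%N -> D g -> cong (p ^ r) f g ->
  cong (p ^ (r + s)) (fun v => f v ^+ (p ^ s)) (fun v => g v ^+ (p ^ s)).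
Proof.
move=> pp r0 Dg fg; elim: s => [|s IHs]; first by rewrite addn0 expn0.
have [h [Dh hE]] := cong_expp pp (ltn_addr s r0) (D_exp (p ^ s) Dg) IHs.
by rewrite addnS; exists h; split=> // v; rewrite expnSr !exprM hE.
Qed.

(** Only the p-part of the exponent raises the precision. In a term d f^(n/d) this gain makes up for
    the power of p that d lacks with respect to n. *)
Lemma cong_exp_logn (p r n : nat) f g : prime p -> (0 < r)%N -> D g -> cong (p ^ r) f g ->
  cong (p ^ (r + logn p n)) (fun v => f v ^+ n) (fun v => g v ^+ n).
Proof.
move=> pp r0 Dg fg; have /dvdnP[k nE] := pfactor_dvdnn p n.
have [h [Dh hE]] := cong_exp k (D_exp _ Dg) (cong_exp_pow (logn p n) pp r0 Dg fg).
have fE (u : (V -> int) -> int) v : u v ^+ n = u v ^+ (p ^ logn p n) ^+ k.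
  by rewrite -exprM mulnC -nE.
by exists h; split=> // v; rewrite !fE hE.
Qed.

Lemma cong_addX (p : nat) f g : prime p -> D f -> D g ->
  cong p (fun v => (f v + g v) ^+ p) (fun v => f v ^+ p + g v ^+ p).
Proof.
case: p => [//|p] pp Df Dg; pose c i := ('C(p.+1, i) %/ p.+1)%N.
exists (fun v => \sum_(i < p) (c i.+1)%:Z * (f v ^+ (p - i) * g v ^+ i.+1)).
split; first by apply: D_sum => i _; apply: D_mul; [exact: D_const|apply: D_mul; exact: D_exp].
move=> v; rewrite exprDn big_ord_recl big_ord_recr subn0 bin0 expr0 mulr1 mulr1n.
rewrite lift0 subnn expr0 mul1r binn mulr1n -addrA [X in _ = _ + X]addrC.
congr (_ + (_ + _)); rewrite mulr_sumr; apply: eq_bigr => i _.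
have cE : 'C(p.+1, i.+1) = (p.+1 * c i.+1)%N.
  by rewrite mulnC divnK // prime_dvd_bin //= ltnS ltn_ord.
by rewrite lift0 /= subSS cE -mulr_natl natz PoszM -!mulrA.
Qed.

Lemma cong_fermat (p : nat) (c : int) : prime p ->
  @cong V p (fun=> c) (fun=> c ^+ p).
Proof.
move=> pp; have p0 := prime_gt0 pp.
have [a caE] : exists a : nat, c = a%:Z + (c %/ p%:Z)%Z * p%:Z.
  exists `|(c %% p%:Z)%Z|%N; rewrite gez0_abs; first by rewrite addrC -divz_eq.
  by rewrite modz_ge0 // eqz_nat -lt0n.
have ca : @cong V p (fun=> c) (fun=> a%:Z).
  by exists (fun=> (c %/ p%:Z)%Z); split=> [|v]; [exact: D_const | rewrite mulrC].
apply: cong_trans ca (cong_trans _ (cong_sym (cong_exp p (D_const V a%:Z) ca))).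
have : (a%:Z == a%:Z ^+ p %[mod p%:Z])%Z.
  have -> : a%:Z ^+ p = (a ^ p)%N%:Z by rewrite -!natz natrX.
  by rewrite !modz_nat eqz_nat eq_sym fermat_little.
rewrite eqz_mod_dvd => /dvdzP[k aE]; exists (fun=> k).
by split=> [|_]; [exact: D_const | rewrite mulrC -aE; ring].
Qed.

(** Modulo p both sides are additive and multiplicative in f, so the claim spreads from the
    variables to all expressions; constants are Fermat's little theorem. *)
Lemma cong_frobenius (p : nat) (F : (V -> int) -> V -> int) f : prime p ->
  (forall x, cong p (fun v => F v x) (fun v => v x ^+ p)) -> D f ->
  cong p (fun v => f (F v)) (fun v => f v ^+ p).
Proof.
move=> pp Fx [e eE].
suff [h [Dh hE]] : cong p (fun v => zeval (F v) e) (fun v => zeval v e ^+ p).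
  by exists h; split=> // v; rewrite !eE hE.
have De u : D (fun v : V -> int => zeval v u) by exists u.
elim: {f eE} e => [x|c|u IHu w IHw|u IHu w IHw] //=.
- by rewrite intz; apply: cong_fermat.
- apply: cong_trans (cong_add IHu IHw) _; apply: cong_sym; exact: (cong_addX pp).
- have DF := D_cong (D_exp p (De w)) IHw.
  have [h [Dh hE]] := cong_mul (D_exp p (De u)) DF IHu IHw.
  by exists h; split=> // v; rewrite exprMn hE.
Qed.

End Congruences.

Notation "\dsum_ ( d | n ) F" := (\sum_(1 <= d < n.+1 | (d %| n)%N) F)
  (at level 41, d, n at level 40, F at level 41) : ring_scope.

Lemma dsum_recr (R : nmodType) (n : nat) (G : nat -> R) : (0 < n)%N ->
  \dsum_(d | n) G d = \sum_(1 <= d < n | (d %| n)%N) G d + G n.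
Proof. by move=> n0; rewrite big_mkcond big_nat_recr //= dvdnn -big_mkcond. Qed.

Lemma dsum_widen (R : nmodType) (n N : nat) (G : nat -> R) : (0 < n <= N)%N ->
  \dsum_(d | n) G d = \sum_(1 <= d < N.+1 | (d %| n)%N) G d.
Proof.
move=> /andP[n0 nN]; rewrite [RHS](big_cat_nat (n := n.+1)) //=.
rewrite [X in _ + X]big_nat_cond [X in _ + X]big_pred0; first by rewrite addr0.
by move=> d; apply/negP => /andP[/andP[nd _] dn]; have := dvdn_leq n0 dn; rewrite leqNgt nd.
Qed.

Lemma wc_id m n : (0 < n)%N -> wc m n n = n.
Proof. by move=> n0; rewrite /wc divnn n0 qint1 mulr1. Qed.

Lemma wcM1 m n d : (1 - m) * wc m n d = d%:Z * (1 - m ^+ (n %/ d)).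
Proof. by rewrite -qintM1 /wc; ring. Qed.

Lemma dvdn_div_gt0 n d : (0 < n)%N -> (d %| n)%N -> (0 < n %/ d)%N.
Proof.
move=> n0 dn; have d0 := dvdn_gt0 n0 dn.
by rewrite divn_gt0 //; apply: dvdn_leq.
Qed.

Lemma logn_div_prime p n : prime p -> (0 < n)%N -> (p %| n)%N ->
  logn p n = (logn p (n %/ p)).+1.
Proof.
move=> pp n0 pn; have p0 := prime_gt0 pp; have np0 := dvdn_div_gt0 n0 pn.
by rewrite -{1}(divnK pn) lognM // (logn_prime _ pp) eqxx addn1.
Qed.

Section Dwork.
Variables (V : Type) (m : int) (F : nat -> (V -> int) -> V -> int).
Variable theta : nat -> ((V -> int) -> int) -> (V -> int) -> int.
Hypothesis D_frob : forall p x, D (fun v => F p v x).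
Hypothesis D_theta : forall k f, D f -> D (theta k f).
Hypothesis theta1 : forall f v, D f -> theta 1 f v = f v.
(** For powers this comes from f^k = (f^p)^(k/p) and f^p = f o F_p modulo p. For Psi^k and psi^k,
    which act by substitution, both sides are equal. *)
Hypothesis theta_frob : forall p k f, prime p -> (0 < k)%N -> (p %| k)%N -> D f ->
  cong (p ^ logn p k) (theta k f) (fun v => theta (k %/ p) f (F p v)).

Definition wphi (a : nat -> (V -> int) -> int) n v : int :=
  \dsum_(d | n) (wc m n d * theta (n %/ d) (a d) v).

(* Dwork's criterion. A prime p dividing m - 1 divides every [wc m n d] to the order v_p(n), so
   the sums [wphi a n] vanish mod p^v_p(n); for any other p the factor 1 - m is invertible, and
   after multiplying by it the coefficients become d (1 - m^(n/d)), where m^k = m^(k/p)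
   modulo p^(v_p(k)). *)
Definition dwork (g : nat -> (V -> int) -> int) := forall p n,
  prime p -> (0 < n)%N -> (p %| n)%N ->
  if (p%:Z %| m - 1)%Z then cong (p ^ logn p n) (g n) (fun=> 0)
  else cong (p ^ logn p n) (g n) (fun v => g (n %/ p)%N (F p v)).

Lemma D_wphi a n : (forall d, D (a d)) -> D (wphi a n).
Proof.
by move=> Da; apply: D_sum => d _; apply: D_mul; [exact: D_const|exact: D_theta].
Qed.

(** The quotient has to be a polynomial: with u c + w N = 1 and quotient h for the multiples, u h +
    w (f - g) serves. *)
Lemma cong_unit N (c : int) (f g : (V -> int) -> int) : coprimez c N%:Z -> D f -> D g ->
  cong N (fun v => c * f v) (fun v => c * g v) -> cong N f g.
Proof.
move=> /coprimezP[[u w] /= uw] Df Dg [h [Dh hE]].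
exists (fun v => u * h v + w * (f v - g v)); split.
  by apply: D_add; apply: D_mul; rewrite //; [exact: D_const|exact: D_const|exact: D_sub].
move=> v; have fg : c * (f v - g v) = N%:Z * h v by rewrite mulrBr hE; ring.
have -> : N%:Z * (u * h v + w * (f v - g v)) = (u * c + w * N%:Z) * (f v - g v).
  by rewrite mulrDl -(mulrA u) fg; ring.
by rewrite uw; ring.
Qed.

Lemma cong_pow_const (p k : nat) : prime p -> (0 < k)%N -> (p %| k)%N ->
  @cong V (p ^ logn p k) (fun=> m ^+ k) (fun=> m ^+ (k %/ p)).
Proof.
move=> pp k0 pk; rewrite (logn_div_prime pp k0 pk) -add1n.
have mp : @cong V (p ^ 1) (fun=> m ^+ p) (fun=> m).
  by rewrite expn1; apply/cong_sym/cong_fermat.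
have [h [Dh hE]] := cong_exp_logn (r := 1) (k %/ p) pp isT (D_const V m) mp.
by exists h; split=> // v; rewrite -hE -exprM mulnC divnK.
Qed.

Lemma coprimez_1m (p n : nat) : prime p -> ~~ (p%:Z %| m - 1)%Z ->
  coprimez (1 - m) (p ^ n)%N%:Z.
Proof.
move=> pp pm; rewrite /coprimez /gcdz eqz_nat absz_nat -/(coprime _ _) coprime_sym.
by rewrite coprimeXl // prime_coprime //; move: pm; rewrite -opprB rpredN dvdzE.
Qed.

(** If d does not divide n/p, then p does not divide n/d, so p^v_p(n) divides d and the term
    vanishes. Otherwise d supplies v_p(d), and the congruences for theta and for m^(n/d) supply
    v_p(n/d). *)
Lemma wc_frob p n d f : prime p -> (0 < n)%N -> (p %| n)%N -> ~~ (p%:Z %| m - 1)%Z ->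
  (d %| n)%N -> D f ->
  cong (p ^ logn p n) (fun v => wc m n d * theta (n %/ d) f v)
    (fun v => if (d %| n %/ p)%N then wc m (n %/ p) d * theta (n %/ p %/ d) f (F p v) else 0).
Proof.
move=> pp n0 pn pm dn Df; have nd0 := dvdn_div_gt0 n0 dn.
have d0 := dvdn_gt0 n0 dn.
have lognE : (logn p n = logn p d + logn p (n %/ d))%N by rewrite -lognM // mulnC divnK.
have Dth : D (theta (n %/ d) f) by apply: D_theta.
case: (boolP (d %| n %/ p)%N) => [dnp|ndnp]; last first.
  exists (fun v => (wc m n d %/ (p ^ logn p n)%N%:Z)%Z * theta (n %/ d) f v).
  split; first by apply: D_mul => //; exact: D_const.
  move=> v; rewrite add0r mulrA [_ * (_ %/ _)%Z]mulrC divzK // /wc dvdz_mulr //.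
  rewrite lognE; suff /eqP-> : logn p (n %/ d) == 0%N by rewrite addn0; exact: pfactor_dvdnn.
  rewrite -leqn0 leqNgt logn_gt0 mem_primes pp nd0 /=; apply: contra ndnp => pnd.
  by rewrite dvdn_divRL // mulnC -dvdn_divRL.
have pnd : (p %| n %/ d)%N by rewrite dvdn_divRL // mulnC -dvdn_divRL.
have ndC : (n %/ p %/ d = n %/ d %/ p)%N by rewrite -!divnMA mulnC.
have Dth' : D (fun v => theta (n %/ d %/ p) f (F p v)).
  by apply: D_comp; [exact: D_frob | exact: D_theta].
apply: (cong_unit (coprimez_1m (logn p n) pp pm)).
- by apply: D_mul => //; exact: D_const.
- by apply: D_mul; [exact: D_const | rewrite ndC].
have [a [Da aE]] := theta_frob pp nd0 pnd Df.
have [b [Db bE]] := cong_pow_const pp nd0 pnd.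
have [c dE] : exists c : int, d%:Z = (p ^ logn p d)%N%:Z * c.
  have /dvdnP[j dE] := pfactor_dvdnn p d; exists j%:Z.
  by rewrite -PoszM mulnC -dE.
pose t v := theta (n %/ d %/ p) f (F p v).
exists (fun v => c * ((1 - m ^+ (n %/ d)) * a v - b v * t v)); split.
  apply: D_mul; first exact: D_const.
  apply: D_sub; apply: D_mul => //; exact: D_const.
have wcA k e (x : int) : (1 - m) * (wc m k e * x) = e%:Z * (1 - m ^+ (k %/ e)) * x.
  by rewrite -wcM1; ring.
move=> v; rewrite !wcA ndC lognE expnD PoszM.
have tE := aE v; rewrite -/(t v) in tE; have mE := bE v.
by rewrite -/(t v) tE mE dE; ring.
Qed.

Lemma wphi_dwork a : (forall d, D (a d)) -> dwork (wphi a).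
Proof.
move=> Da p n pp n0 pn; case: ifPn => pm.
  have [h [Dh hE]] : cong (p ^ logn p n) (wphi a n) (fun v => \dsum_(d | n) 0); last first.
    by exists h; split=> // v; rewrite hE big1.
  apply: cong_sum => d dn.
  exists (fun v => (wc m n d %/ (p ^ logn p n)%N%:Z)%Z * theta (n %/ d) (a d) v).
  split; first by apply: D_mul; [exact: D_const | exact: D_theta].
  by move=> v; rewrite add0r mulrA [_ * (_ %/ _)%Z]mulrC divzK // dvdz_wc.
have np0 : (0 < n %/ p <= n)%N by rewrite dvdn_div_gt0 //= leq_div.
have [h [Dh hE]] : cong (p ^ logn p n) (wphi a n) (fun v => \dsum_(d | n)
    if (d %| n %/ p)%N then wc m (n %/ p) d * theta (n %/ p %/ d) (a d) (F p v) else 0).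
  by apply: cong_sum => d dn; exact: (wc_frob pp n0 pn pm dn (Da d)).
exists h; split=> // v; rewrite hE; congr (_ + _).
rewrite /wphi (dsum_widen _ np0) -big_mkcondr; apply: eq_bigl => d.
apply/andP/idP => [[]//|dnp]; split=> //; exact: dvdn_trans dnp (dvdn_div pn).
Qed.

Lemma eq_dwork g h : (forall n v, (0 < n)%N -> g n v = h n v) -> dwork g -> dwork h.
Proof.
move=> gh dg p n pp n0 pn; have := dg p n pp n0 pn.
have np0 := dvdn_div_gt0 n0 pn.
by case: ifP => _ [k [Dk kE]]; exists k; split=> // v; rewrite -!gh // kE.
Qed.

(** The value of n a_n is forced: g_n minus the terms with d < n. Those terms form a sum [wphi] that
    obeys the same congruences as g and agrees with g at n/p, so every p^v_p(n) divides the
    difference, and therefore n does. *)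
Lemma dwork_exists g : (forall n, (0 < n)%N -> D (g n)) -> dwork g ->
  exists a, (forall d, D (a d)) /\ forall n v, (0 < n)%N -> wphi a n v = g n v.
Proof.
move=> Dg dg.
pose P n (a : nat -> (V -> int) -> int) t := D t /\ ((0 < n)%N -> forall v,
  \sum_(1 <= d < n | (d %| n)%N) wc m n d * theta (n %/ d) (a d) v + n%:Z * t v = g n v).
have wphiE n a v : (0 < n)%N -> D (a n) -> wphi a n v =
    \sum_(1 <= d < n | (d %| n)%N) wc m n d * theta (n %/ d) (a d) v + n%:Z * a n v.
  by move=> n0 Dn; rewrite /wphi dsum_recr // divnn n0 theta1 // wc_id.
have [|n a aP|a aP] := @strong_choice _ (fun=> 0) P; last first.
- exists a; split=> [d|n v n0]; first by have [] := aP d.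
  by have [Dn aE] := aP n; rewrite wphiE // aE.
- case: (posnP n) => [->|n0]; first by exists (fun=> 0); split=> //; exact: D_const.
  (* Entries from n on are set to 0: all of [b] is then polynomial, as [wphi_dwork] requires, and
     the term d = n disappears. *)
  pose b k := if (k < n)%N then a k else fun=> 0.
  have Db k : D (b k) by rewrite /b; case: ifP => [/aP[]|_] //; exact: D_const.
  have bE k v : (0 < k < n)%N -> wphi b k v = g k v.
    move=> /andP[k0 kn]; rewrite wphiE //; have [_ <- //] := aP k kn.
    rewrite /b kn; congr (_ + _); rewrite big_nat_cond [RHS]big_nat_cond.
    by apply: eq_bigr => d /andP[/andP[_ dk] _]; rewrite (ltn_trans dk kn).
  have Rn v : wphi b n v = \sum_(1 <= d < n | (d %| n)%N) wc m n d * theta (n %/ d) (a d) v.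
    rewrite wphiE // {2}/b ltnn mulr0 addr0 big_nat_cond [RHS]big_nat_cond.
    by apply: eq_bigr => d /andP[/andP[_ dk] _]; rewrite /b dk.
  have Df : D (fun v => g n v - wphi b n v) by apply: D_sub; [exact: Dg | exact: D_wphi].
  have [p pp pn|h [Dh hE]] := cong0_all_primes n0 Df.
    have p1 := prime_gt1 pp; have np0 := dvdn_div_gt0 n0 pn.
    have := dg p n pp n0 pn; have := wphi_dwork Db pp n0 pn.
    case: ifP => _ [k [Dk kE]] [l [Dl lE]]; exists (fun v => l v - k v).
      by split=> [|v]; [exact: D_sub | rewrite kE lE; ring].
    split=> [|v]; first exact: D_sub.
    by rewrite kE lE bE ?np0 ?ltn_Pdiv //; ring.
  exists h; split=> // _ v; rewrite -Rn.
  by have := hE v; rewrite add0r => <-; ring.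
- move=> n a b t ab [Dt tE]; split=> // n0 v; rewrite -tE //; congr (_ + _).
  rewrite big_nat_cond [RHS]big_nat_cond.
  by apply: eq_bigr => d /andP[/andP[_ dn] _]; rewrite ab.
Qed.

Lemma dworkD g h : dwork g -> dwork h -> dwork (fun n v => g n v + h n v).
Proof.
move=> dg dh p n pp n0 pn; have := dg p n pp n0 pn; have := dh p n pp n0 pn.
case: ifP => _ gc hc; have [k [Dk kE]] := cong_add hc gc; exists k; split=> // v; rewrite kE //.
Qed.

Lemma dworkM g h : (forall n, (0 < n)%N -> D (g n)) -> (forall n, (0 < n)%N -> D (h n)) ->
  dwork g -> dwork h -> dwork (fun n v => g n v * h n v).
Proof.
move=> Dg Dh dg dh p n pp n0 pn; have := dg p n pp n0 pn; have := dh p n pp n0 pn.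
have np0 := dvdn_div_gt0 n0 pn.
case: ifP => _ hc gc.
  have [k [Dk kE]] := cong_mul (D_const V 0) (Dh n n0) gc hc.
  by exists k; split=> // v; rewrite kE mul0r.
have Dg' : D (fun v => g (n %/ p)%N (F p v)) by apply: D_comp; [exact: D_frob|exact: Dg].
exact: cong_mul Dg' (Dh n n0) gc hc.
Qed.

Lemma dworkZ (c : int) g : dwork g -> dwork (fun n v => c * g n v).
Proof.
move=> dg p n pp n0 pn; have := dg p n pp n0 pn.
by case: ifP => _ [k [Dk kE]]; exists (fun v => c * k v);
  split=> [|v]; rewrite ?kE; [exact: D_mul (D_const V c) Dk|ring|exact: D_mul (D_const V c) Dk|ring].
Qed.

End Dwork.

(** * Newton's identities and Witt coordinates *)

(* Power sums in terms of elementary symmetric functions [E i]; [E 0] is never read. *)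
Definition nu (A : comPzRingType) (E : nat -> A) (k : nat) : A := adams (fun i _ => E i) k 0.

Lemma adams_nu (A : comPzRingType) (lam : nat -> A -> A) k r : adams lam k r = nu (lam^~ r) k.
Proof.
rewrite /nu /adams; congr nth; move: k; elim=> //= k <-; congr rcons.
Qed.

Lemma nuE (A : comPzRingType) (E : nat -> A) k : (0 < k)%N ->
  nu E k = \sum_(1 <= i < k) (-1) ^+ i.+1 * E i * nu E (k - i) + (-1) ^+ k.+1 * k%:R * E k.
Proof.
pose s := adams_seq (fun i (_ : A) => E i) 0.
have size_s n : size (s n) = n by elim: n => //= n IHn; rewrite size_rcons IHn.
have sE n j : (j < n)%N -> nth 0 (s n) j = nu E j.+1.
  elim: n => // n IHn; rewrite ltnS leq_eqVlt => /orP[/eqP-> //|jn].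
  by rewrite /= nth_rcons size_s jn IHn.
case: k => // k _; rewrite {1}/nu /adams /= nth_rcons size_s ltnn eqxx.
congr (_ + _); apply: eq_big_nat => i /andP[i0 ik].
by rewrite sE ?prednK ?subn_gt0 //; lia.
Qed.

Lemma nu1 (A : comPzRingType) (E : nat -> A) : nu E 1 = E 1%N.
Proof. by rewrite nuE // big_geq // add0r sqrrN expr1n !mul1r. Qed.

Lemma eq_nu (A : comPzRingType) (E E' : nat -> A) k :
  (forall i, (0 < i <= k)%N -> E i = E' i) -> nu E k = nu E' k.
Proof.
case: k => [//|k]; elim/ltn_ind: k => k IHk EE'.
rewrite !nuE // (EE' k.+1) ?leqnn //; congr (_ + _).
apply: eq_big_nat => i /andP[i0 ik]; rewrite EE' ?i0 1?ltnW //; congr (_ * _).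
rewrite -(prednK (n := k.+1 - i)) ?subn_gt0 //; apply: IHk.
  by lia.
by move=> j /andP[j0 ji]; apply: EE'; rewrite j0 /=; lia.
Qed.

(** E_k enters [nu E k] with coefficient k up to sign, which can be cancelled over Z. Equalities of
    integer sequences are reduced to power sums by this lemma. *)
Lemma nu_inj (E E' : nat -> int) n : E 0%N = E' 0%N ->
  (forall k, (0 < k <= n)%N -> nu E k = nu E' k) -> forall k, (k <= n)%N -> E k = E' k.
Proof.
move=> E0 nuEE' k; elim/ltn_ind: k => -[//|k] IHk kn.
have := nuEE' k.+1; rewrite kn !nuE // => /(_ isT).
have -> : \sum_(1 <= i < k.+1) (-1) ^+ i.+1 * E i * nu E (k.+1 - i) =
          \sum_(1 <= i < k.+1) (-1) ^+ i.+1 * E' i * nu E' (k.+1 - i).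
  apply: eq_big_nat => i /andP[i0 ik]; rewrite IHk ?nuEE' //; lia.
by move/addrI/mulfI; apply; rewrite mulf_neq0 ?signr_eq0 ?pnatr_eq0.
Qed.

(** Product of power series, that is, the addition of Lambda(A). *)
Definition conv (A : comPzRingType) (E E' : nat -> A) (n : nat) : A :=
  \sum_(i < n.+1) E i * E' (n - i)%N.

(** Congruence modulo X^(N+1): polynomials stand for truncated power series. *)
Definition eqX N (P Q : {poly int}) := forall i, (i <= N)%N -> P`_i = Q`_i.

Lemma eqX_mul N P P' Q Q' : eqX N P P' -> eqX N Q Q' -> eqX N (P * Q) (P' * Q').
Proof.
move=> PP QQ i iN; rewrite !coefM; apply: eq_bigr => j _; rewrite PP ?QQ //.
  by rewrite (leq_trans (leq_subr _ _)).
by rewrite (leq_trans _ iN) // -ltnS.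
Qed.

(* [-t P'/P = G] up to degree [N] *)
Definition logder N (P G : {poly int}) := eqX N ('X * P^`() + P * G) 0.

Lemma logder_mul N P Q G H : logder N P G -> logder N Q H -> logder N (P * Q) (G + H).
Proof.
move=> PG QH; rewrite /logder derivM.
have -> : 'X * (P^`() * Q + P * Q^`()) + P * Q * (G + H) =
  ('X * P^`() + P * G) * Q + P * ('X * Q^`() + Q * H) by ring.
move=> i iN; rewrite coefD coef0.
rewrite (eqX_mul PG (Q' := Q)) // (eqX_mul (P' := P) _ QH) //.
by rewrite mul0r mulr0 !coef0 addr0.
Qed.

Lemma logder_prod N (I : Type) (r : seq I) (P : pred I) (p g : I -> {poly int}) :
  (forall i, P i -> logder N (p i) (g i)) ->
  logder N (\prod_(i <- r | P i) p i) (\sum_(i <- r | P i) g i).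
Proof.
move=> pg; apply: (big_rec2 (fun P G => logder N P G)) => [|i G Q Pi QG].
  by move=> i _; rewrite mul1r addr0 -[1]/(1%:P) derivC mulr0.
exact: logder_mul (pg i Pi) QG.
Qed.

Lemma coef_logder (P G : {poly int}) k : (0 < k)%N -> P`_0 = 1 -> G`_0 = 0 ->
  ('X * P^`() + P * G)`_k = P`_k *+ k + (G`_k + \sum_(1 <= i < k) P`_i * G`_(k - i)).
Proof.
case: k => // k _ P0 G0; rewrite coefD mulrC coefMX /= coef_deriv coefM; congr (_ + _).
rewrite -(big_mkord xpredT (fun i => P`_i * G`_(k.+1 - i))) big_nat_recr //= subnn G0 mulr0 addr0.
by rewrite big_ltn // P0 mul1r subn0.
Qed.

(** For P = 1 - E_1 t + E_2 t^2 - ... the coefficient of t^k in t P' + P G = 0 is Newton's identity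
    for the coefficients of G. *)
Lemma logder_nuP N (E : nat -> int) (P G : {poly int}) : E 0%N = 1 -> G`_0 = 0 ->
  (forall i, (i <= N)%N -> P`_i = (-1) ^+ i * E i) ->
  logder N P G <-> forall k, (0 < k <= N)%N -> nu E k = G`_k.
Proof.
move=> E0 G0 PE; have P0 : P`_0 = 1 by rewrite PE // E0.
have step k : (0 < k <= N)%N -> (forall j, (0 < j < k)%N -> nu E j = G`_j) ->
    ('X * P^`() + P * G)`_k = G`_k - nu E k.
  move=> /andP[k0 kN] IH; rewrite coef_logder // nuE // PE //.
  have -> : \sum_(1 <= i < k) P`_i * G`_(k - i) =
            - \sum_(1 <= i < k) (-1) ^+ i.+1 * E i * nu E (k - i).
    rewrite -sumrN; apply: eq_big_nat => i /andP[i0 ik].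
    by rewrite PE ?IH; [rewrite exprS; ring|lia|lia].
  by rewrite -mulr_natr exprS; ring.
split=> [PG k|nuG i iN].
  elim/ltn_ind: k => k IHk kN; have := step k kN.
  rewrite PG ?coef0; last by case/andP: kN.
  move=> H; apply/eqP; rewrite eq_sym -subr_eq0 -H // => j jk; apply: IHk; lia.
case: (posnP i) => [->|i0]; first by rewrite coefD mulrC coefMX coefM big_ord1 G0 mulr0 addr0 coef0.
by rewrite step ?i0 // => [|j jk]; rewrite nuG ?subrr ?coef0 ?i0 //; lia.
Qed.

Definition egen N (E : nat -> int) : {poly int} := \poly_(i < N.+1) ((-1) ^+ i * E i).
Definition ngen N (E : nat -> int) : {poly int} :=
  \poly_(i < N.+1) (if i == 0%N then 0 else nu E i).

Lemma logder_egen N E : E 0%N = 1 -> logder N (egen N E) (ngen N E).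
Proof.
move=> E0; apply/(logder_nuP (E := E)) => // [|i iN|k /andP[k0 kN]].
- by rewrite coef_poly.
- by rewrite coef_poly ltnS iN.
- by rewrite coef_poly ltnS kN; case: k k0 {kN}.
Qed.

Lemma conv0 (A : comPzRingType) (E E' : nat -> A) : conv E E' 0 = E 0%N * E' 0%N.
Proof. by rewrite /conv big_ord1. Qed.

Lemma nu_conv E E' k : E 0%N = 1 -> E' 0%N = 1 -> (0 < k)%N ->
  nu (conv E E') k = (nu E k + nu E' k :> int).
Proof.
move=> E0 E'0 k0.
have /(logder_nuP (E := conv E E')) H := logder_mul (logder_egen (N := k) E0) (logder_egen (N := k) E'0).
rewrite H ?conv0 ?E0 ?E'0 ?mulr1 ?k0 ?leqnn //.
- by rewrite coefD !coef_poly ltnSn; case: k k0 {H}.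
- by rewrite coefD !coef_poly addr0.
- move=> i ik; rewrite coefM /conv mulr_sumr; apply: eq_bigr => j _.
  rewrite !coef_poly !ltnS.
  have -> : (j <= k)%N by rewrite (leq_trans _ ik) // -ltnS.
  have -> : (i - j <= k)%N by rewrite (leq_trans (leq_subr _ _)).
  have -> : (-1) ^+ i = (-1) ^+ j * (-1) ^+ (i - j) :> int.
    by rewrite -exprD subnKC // -ltnS.
  by ring.
Qed.

Definition wprod (a : nat -> int) N : {poly int} :=
  \prod_(1 <= d < N.+1) (1 - (a d)%:P * 'X^d).

(** Geometric series: -t (1 - a t^d)' / (1 - a t^d) = d (a t^d + a^2 t^(2d) + ...). *)
Lemma logder_factor N (a : int) d : (0 < d)%N ->
  logder N (1 - a%:P * 'X^d)
    (\poly_(k < N.+1) (if (0 < k)%N && (d %| k)%N then d%:Z * a ^+ (k %/ d) else 0)).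
Proof.
move=> d0 k kN; set G := \poly_(k < _) _.
have GE j : (j <= N)%N -> G`_j = if (0 < j)%N && (d %| j)%N then d%:Z * a ^+ (j %/ d) else 0.
  by move=> jN; rewrite coef_poly ltnS jN.
have -> : 'X * (1 - a%:P * 'X^d)^`() = - (d%:Z * a)%:P * 'X^d.
  case: d d0 {G GE} => // d _.
  rewrite -[1]/(1%:P) derivB derivC mul_polyC derivZ derivXn -mul_polyC exprS /= -mulr_natl.
  by rewrite polyCM -[(d.+1)%:Z]natz polyC_natr; ring.
rewrite coefD mulNr coefN coefCM coefXn mulrBl mul1r coefB -(mulrA a%:P) coefCM coefXnM coef0.
rewrite GE //; case: (ltngtP k d) => [kd|dk|->].
- case: (posnP k) => [_|k0] /=; first by ring.
  by rewrite gtnNdvd //; ring.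
- have k0 : (0 < k)%N by apply: leq_ltn_trans dk.
  rewrite GE ?(leq_trans (leq_subr _ _)) // k0 subn_gt0 dk /=.
  have -> : (d %| k - d)%N = (d %| k)%N by rewrite -{2}(subnK (ltnW dk)) dvdn_addl.
  case: ifP => dvk; last by ring.
  have -> : (k %/ d = ((k - d) %/ d).+1)%N.
    by rewrite -{1}(subnK (ltnW dk)) divnDr // divnn d0 addn1.
  by rewrite exprS; ring.
- rewrite d0 dvdnn /= divnn d0 subnn GE //=; ring.
Qed.

Lemma coef0_wprod a N : (wprod a N)`_0 = 1.
Proof.
rewrite /wprod big_nat_cond; elim/big_rec: _ => [|d P /andP[/andP[d0 _] _] P0].
  by rewrite coef1.
rewrite coefM big_ord1 /= P0 mulr1 coefB coef1 coefCM coefXn.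
by case: d d0 => // d _; rewrite mulr0 subr0.
Qed.

Lemma eqX_wprod a N M : (N <= M)%N -> eqX N (wprod a M) (wprod a N).
Proof.
move=> NM i iN; rewrite /wprod (big_cat_nat (n := N.+1)) //=.
suff H : eqX N (\prod_(N.+1 <= d < M.+1) (1 - (a d)%:P * 'X^d)) 1.
  by rewrite (eqX_mul (P' := wprod a N) _ H) ?mulr1.
rewrite big_nat_cond; elim/big_rec: _ => [//|d P /andP[/andP[dN _] _] P1].
have F1 : eqX N (1 - (a d)%:P * 'X^d) 1.
  move=> j jN; rewrite coefB coefCM coefXn; case: eqP => [jd|_]; last by rewrite mulr0 subr0.
  by move: dN; rewrite -jd ltnNge jN.
by move=> j jN; rewrite (eqX_mul F1 P1) // mulr1.
Qed.

(** Factors beyond n do not touch the coefficient of t^n, so the diagonal coefficients of the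
    partial products describe the infinite product. Its logarithmic derivative is the sum over the
    factors. *)
Lemma nu_wprod (a E : nat -> int) N : E 0%N = 1 ->
  (forall n, (n <= N)%N -> (wprod a n)`_n = (-1) ^+ n * E n) ->
  forall k, (0 < k <= N)%N -> nu E k = \dsum_(d | k) (d%:Z * a d ^+ (k %/ d)).
Proof.
move=> E0 aE k /andP[k0 kN].
have := @logder_prod N _ (index_iota 1 N.+1) (fun d => 0 < d)%N
  (fun d => 1 - (a d)%:P * 'X^d) _ (fun d d0 => logder_factor (N := N) (a d) d0).
rewrite -[X in logder N X _](_ : wprod a N = _); last first.
  by rewrite /wprod big_nat_cond [RHS]big_nat_cond; apply: eq_bigl => d; case: d; rewrite ?andbF ?andbT.
move/(logder_nuP (E := E)) => -> //; last by rewrite k0.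
- rewrite coef_sum (dsum_widen (N := N)) ?k0 // [RHS]big_mkcond /= big_nat_cond [RHS]big_nat_cond.
  apply: congr_big => // [d|d /andP[/andP[d0 _] _]]; first by case: d; rewrite ?andbF ?andbT.
  by rewrite coef_poly ltnS kN k0.
- by rewrite coef_sum big1 // => d _; rewrite coef_poly.
- by move=> i iN; rewrite (eqX_wprod a iN (leqnn i)) aE.
Qed.

(** [esym] over any finite index type: the lambda-ring axioms need pairs and subsets as indices. *)
Definition esymF (I : finType) (A : comPzRingType) (z : I -> A) (i : nat) : A :=
  \sum_(S : {set I} | #|S| == i) \prod_(j in S) z j.

(** Keeping both [a] and [b] covers the product of the 1 - z_i t as well as that of the X - y_i. *)
Lemma prod_add_esymF (I : finType) (A : comPzRingType) (a b : A) (z : I -> A) :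
  \prod_i (a + b * z i) = \sum_(n < #|I|.+1) a ^+ (#|I| - n) * b ^+ n * esymF z n.
Proof.
under eq_bigr do rewrite addrC.
rewrite bigA_distr (partition_big (fun J : {set I} => inord #|J| : 'I_#|I|.+1) xpredT) //=.
apply: eq_bigr => n _; rewrite /esymF mulr_sumr; apply: eq_big => [J|J /eqP Jn].
  by rewrite -val_eqE /= inordK // ltnS max_card.
have cJ : #|J| = n by rewrite -Jn inordK // ltnS max_card.
transitivity ((\prod_(i in J) (b * z i)) * \prod_(i in ~: J) a).
  rewrite (bigID (mem J)) /=; congr (_ * _); first by apply: eq_bigr => i ->.
  by apply: eq_big => i; rewrite ?inE // => /negbTE->.
by rewrite big_split /= !prodr_const (cardsCs (~: J)) setCK cJ; ring.
Qed.

Lemma esymF_gt (I : finType) (A : comPzRingType) (z : I -> A) n : (#|I| < n)%N -> esymF z n = 0.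
Proof.
by move=> In; apply: big1 => S /eqP Sn; have := max_card S; rewrite Sn leqNgt In.
Qed.

Lemma esymF0 (I : finType) (A : comPzRingType) (z : I -> A) : esymF z 0 = 1.
Proof.
rewrite /esymF (big_pred1 set0) ?big_set0 // => S; exact: cards_eq0.
Qed.

Lemma coef_prod_esymF (I : finType) (z : I -> int) n :
  (\prod_i (1 - (z i)%:P * 'X^1))`_n = (-1) ^+ n * esymF z n.
Proof.
under eq_bigr => i _ do rewrite expr1 mulrC -mulNr.
rewrite (prod_add_esymF 1 (- 'X) (fun i => (z i)%:P)) coef_sum.
have eC k : esymF (fun i => (z i)%:P) k = (esymF z k)%:P.
  by rewrite /esymF rmorph_sum; apply: eq_bigr => S _; rewrite rmorph_prod.
have tE (k : 'I_#|I|.+1) :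
    (1 ^+ (#|I| - k) * (- 'X) ^+ k * esymF (fun i => (z i)%:P) k)`_n =
    if k == n :> nat then (-1) ^+ n * esymF z n else 0.
  have -> : 1 ^+ (#|I| - k) * (- 'X) ^+ k * esymF (fun i => (z i)%:P) k =
            ((-1) ^+ k * esymF z k)%:P * 'X^k.
    by rewrite expr1n mul1r eC (exprNn 'X) polyCM polyC_exp polyCN polyC1; ring.
  by rewrite coefCM coefXn eq_sym; case: eqP => [->|_]; rewrite ?mulr1 ?mulr0.
rewrite (eq_bigr _ (fun k _ => tE k)) -big_mkcond /=.
case: (ltnP #|I| n) => nI; first by rewrite esymF_gt // mulr0 big1.
rewrite (big_pred1 (inord n)) // => k; apply/eqP/eqP => [kn|->]; last by rewrite inordK.
by apply: val_inj; rewrite /= inordK.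
Qed.

Lemma nu_esymF (I : finType) (z : I -> int) k : (0 < k)%N ->
  nu (esymF z) k = \sum_i z i ^+ k.
Proof.
move=> k0.
have := @logder_prod k _ (index_enum I) xpredT (fun i => 1 - (z i)%:P * 'X^1) _
  (fun i _ => logder_factor (N := k) (z i) (ltn0Sn 0)).
move/(logder_nuP (E := esymF z)) => ->; rewrite ?esymF0 ?k0 ?leqnn //.
- rewrite coef_sum; apply: eq_bigr => i _.
  by rewrite coef_poly ltnSn k0 dvd1n divn1 mul1r.
- by rewrite coef_sum big1 // => i _; rewrite coef_poly.
- by move=> i ik; exact: coef_prod_esymF.
Qed.

(** * Witt coordinates of a power series with polynomial coefficients *)

Section WittCoordinates.
Variable V : Type.
Implicit Types (Q R : (V -> int) -> {poly int}) (a E : nat -> (V -> int) -> int).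

Lemma D_ext (f g : (V -> int) -> int) : f =1 g -> D f -> D g.
Proof. by move=> fg [p fp]; exists p => v; rewrite -fg fp. Qed.

Lemma cong_ext N (f f' g g' : (V -> int) -> int) :
  f =1 f' -> g =1 g' -> cong N f g -> cong N f' g'.
Proof. by move=> ff gg [h [Dh hE]]; exists h; split=> // v; rewrite -ff -gg hE. Qed.

Definition coefD Q := forall i, D (fun v => (Q v)`_i).

Lemma coefD_mul Q R : coefD Q -> coefD R -> coefD (fun v => Q v * R v).
Proof.
move=> DQ DR i; apply: (@D_ext (fun v => \sum_(j < i.+1) (Q v)`_j * (R v)`_(i - j))).
  by move=> v; rewrite coefM.
by apply: D_sum => j _; apply: D_mul.
Qed.

Lemma coefD_factor (f : (V -> int) -> int) d : D f -> coefD (fun v => 1 - (f v)%:P * 'X^d).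
Proof.
move=> Df i; apply: (@D_ext (fun v => (i == 0%N)%:R - f v * (i == d)%:R)).
  by move=> v; rewrite coefB coef1 coefCM coefXn.
by apply: D_sub; [exact: D_const | apply: D_mul => //; exact: D_const].
Qed.

Lemma wprodS (b : nat -> int) n : wprod b n.+1 = wprod b n * (1 - (b n.+1)%:P * 'X^(n.+1)).
Proof. by rewrite /wprod big_nat_recr. Qed.

Lemma wprod0 (b : nat -> int) : wprod b 0 = 1.
Proof. by rewrite /wprod big_geq. Qed.

Lemma eq_wprod (b c : nat -> int) n : (forall d, (0 < d <= n)%N -> b d = c d) ->
  wprod b n = wprod c n.
Proof. by move=> bc; apply: eq_big_nat => d dn; rewrite bc. Qed.

Lemma coefD_wprod a n : (forall d, (d <= n)%N -> D (a d)) -> coefD (fun v => wprod (a^~ v) n).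
Proof.
elim: n => [_|n IHn Da] i.
  by apply: (@D_ext (fun=> (i == 0%N)%:R)) => [v|]; [rewrite wprod0 coef1 | exact: D_const].
apply: (@D_ext (fun v => (wprod (a^~ v) n * (1 - (a n.+1 v)%:P * 'X^(n.+1)))`_i)).
  by move=> v; rewrite wprodS.
apply: coefD_mul; last by apply: coefD_factor; apply: Da.
by apply: IHn => d dn; apply: Da; apply: leqW.
Qed.

(* The factorization 1 - E_1 t + E_2 t^2 - ... = prod_d (1 - a_d t^d). *)
Lemma witt_coords E : (forall n, D (E n)) -> (forall v, E 0%N v = 1) ->
  exists a, (forall d, D (a d)) /\ forall v n, (wprod (a^~ v) n)`_n = (-1) ^+ n * E n v.
Proof.
move=> DE E0.
(* The factor 1 - a_n t^n lowers the coefficient of t^n by a_n, so a_n is the excess of the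
   preceding product over the target. *)
pose P n a t := D t /\ forall v, (0 < n)%N ->
  t v = (wprod (a^~ v) n.-1)`_n - (-1) ^+ n * E n v.
have [|n a aP|a aP] := @strong_choice _ (fun=> 0) P; last first.
- exists a; split=> [d|v n]; first by have [] := aP d.
  case: n => [|n]; first by rewrite wprod0 coef1 E0.
  rewrite wprodS mulrBr mulr1 coefB mulrA coefMXn ltnn subnn coefM big_ord1 subn0.
  by rewrite coefC eqxx coef0_wprod mul1r; have [_ ->] := aP n.+1; rewrite //=; ring.
- case: n aP => [_|n aP]; first by exists (fun=> 0); split=> //; exact: D_const.
  exists (fun v => (wprod (a^~ v) n)`_n.+1 - (-1) ^+ n.+1 * E n.+1 v); split=> //.
  apply: D_sub; last by apply: D_mul => //; exact: D_const.
  by apply: coefD_wprod => d dn; have [] := aP d.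
- move=> n a b t ab [Dt tE]; split=> // v n0; rewrite tE //.
  by rewrite (@eq_wprod (a^~ v) (b^~ v)) // => d /andP[_ dn]; rewrite ab //; lia.
Qed.

Definition ecoef a n v := (-1) ^+ n * (wprod (a^~ v) n)`_n.

Lemma D_ecoef a n : (forall d, D (a d)) -> D (ecoef a n).
Proof. by move=> Da; apply: D_mul; [exact: D_const | apply: coefD_wprod]. Qed.

Lemma ecoef0 a v : ecoef a 0 v = 1.
Proof. by rewrite /ecoef wprod0 coef1 expr0 mul1r. Qed.

Lemma ecoef_wprod a n v : (wprod (a^~ v) n)`_n = (-1) ^+ n * ecoef a n v.
Proof. by rewrite /ecoef mulrA -exprD addnn -signr_odd odd_double mul1r. Qed.

Lemma nu_coords a E v k : E 0%N v = 1 ->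
  (forall n, (wprod (a^~ v) n)`_n = (-1) ^+ n * E n v) -> (0 < k)%N ->
  nu (E^~ v) k = \dsum_(d | k) (d%:Z * a d v ^+ (k %/ d)).
Proof.
move=> E0 aE k0; by rewrite (@nu_wprod (a^~ v) (E^~ v) k) ?E0 ?k0 ?leqnn.
Qed.

Lemma D_nu E k : (forall n, D (E n)) -> (forall v, E 0%N v = 1) -> (0 < k)%N ->
  D (fun v => nu (E^~ v) k).
Proof.
move=> DE E0 k0; have [a [Da aE]] := witt_coords DE E0.
apply: (@D_ext (fun v => \dsum_(d | k) (d%:Z * a d v ^+ (k %/ d)))).
  by move=> v; rewrite -(nu_coords (E0 v) (aE v)).
by apply: D_sum => d _; apply: D_mul; [exact: D_const | exact: D_exp].
Qed.

Definition frobenius_lift (F : nat -> (V -> int) -> V -> int) :=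
  (forall p x, D (fun v => F p v x)) /\
  forall p x, prime p -> cong p (fun v => F p v x) (fun v => v x ^+ p).

Definition fexp k (f : (V -> int) -> int) v := f v ^+ k.

Lemma fexp_frob F : frobenius_lift F -> forall p k f, prime p -> (0 < k)%N -> (p %| k)%N ->
  D f -> cong (p ^ logn p k) (fexp k f) (fun v => fexp (k %/ p) f (F p v)).
Proof.
move=> [DF FL] p k f pp k0 pk Df; rewrite (logn_div_prime pp k0 pk) -add1n.
have DfF : D (fun v => f (F p v)) by apply: D_comp.
have cf : cong (p ^ 1) (fun v => f v ^+ p) (fun v => f (F p v)).
  by rewrite expn1; apply: cong_sym; apply: cong_frobenius => // x; exact: FL.
apply: cong_ext (cong_exp_logn (r := 1) (k %/ p) pp isT DfF cf) => v //=.
by rewrite /fexp -exprM mulnC divnK.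
Qed.

Section PowerDwork.
Variables (m : int) (F : nat -> (V -> int) -> V -> int).
Hypothesis FL : frobenius_lift F.

Lemma power_dwork a : (forall d, D (a d)) -> dwork m F (wphi m fexp a).
Proof.
have [DF _] := FL; apply: wphi_dwork => //; first (by move=> k f Df; exact: D_exp); exact: fexp_frob.
Qed.

Lemma power_dwork_exists g : (forall n, (0 < n)%N -> D (g n)) -> dwork m F g ->
  exists a, (forall d, D (a d)) /\ forall n v, (0 < n)%N -> wphi m fexp a n v = g n v.
Proof.
have [DF _] := FL; apply: dwork_exists => //; first by move=> k f Df; exact: D_exp.
exact: fexp_frob.
Qed.

End PowerDwork.

Lemma wc0 n d : (0 < n)%N -> (d %| n)%N -> wc 0 n d = d.
Proof.
move=> n0 dn; have := dvdn_div_gt0 n0 dn; rewrite /wc; case: (n %/ d)%N => // k _.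
by rewrite /qint big_ord_recl big1 => [|i _]; rewrite ?addr0 ?mulr1 // lift0 expr0n.
Qed.

Lemma wphi0 a n v : (0 < n)%N -> wphi 0 fexp a n v = \dsum_(d | n) (d%:Z * a d v ^+ (n %/ d)).
Proof. by move=> n0; apply: eq_bigr => d dn; rewrite wc0. Qed.

Lemma nu_dwork F E : frobenius_lift F -> (forall n, D (E n)) -> (forall v, E 0%N v = 1) ->
  dwork 0 F (fun n v => nu (E^~ v) n).
Proof.
move=> FL DE E0; have [a [Da aE]] := witt_coords DE E0.
apply: eq_dwork (power_dwork 0 FL Da) => n v n0.
by rewrite wphi0 // (nu_coords (E0 v) (aE v)).
Qed.

(** Converse of [nu_dwork]: the criterion yields integral Witt coordinates, and multiplying out
    their factors yields E. *)
Lemma newton_integral F g : frobenius_lift F -> (forall n, (0 < n)%N -> D (g n)) ->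
  dwork 0 F g ->
  exists E, [/\ forall n, D (E n), forall v, E 0%N v = 1 &
                forall n v, (0 < n)%N -> nu (E^~ v) n = g n v].
Proof.
move=> FL Dg dg; have [a [Da aE]] := power_dwork_exists FL Dg dg.
exists (ecoef a); split=> [n|v|n v n0]; first exact: D_ecoef.
  exact: ecoef0.
by rewrite -aE // wphi0 // (@nu_coords a) ?ecoef0 // => k; exact: ecoef_wprod.
Qed.

Lemma coef_cong_mul N Q Q' R R' : coefD Q' -> coefD R ->
  (forall i, cong N (fun v => (Q v)`_i) (fun v => (Q' v)`_i)) ->
  (forall i, cong N (fun v => (R v)`_i) (fun v => (R' v)`_i)) ->
  forall i, cong N (fun v => (Q v * R v)`_i) (fun v => (Q' v * R' v)`_i).
Proof.
move=> DQ DR QQ RR i.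
apply: (@cong_ext _ (fun v => \sum_(j < i.+1) (Q v)`_j * (R v)`_(i - j)) _
                    (fun v => \sum_(j < i.+1) (Q' v)`_j * (R' v)`_(i - j))).
- by move=> v; rewrite coefM.
- by move=> v; rewrite coefM.
by apply: cong_sum => j _; apply: cong_mul.
Qed.

Lemma wprod_cong N a b n : (forall d, D (a d)) -> (forall d, D (b d)) ->
  (forall d, (0 < d <= n)%N -> cong N (a d) (b d)) ->
  forall i, cong N (fun v => (wprod (a^~ v) n)`_i) (fun v => (wprod (b^~ v) n)`_i).
Proof.
move=> Da Db; elim: n => [_|n IHn ab] i.
  by apply: cong_ext (cong_refl N (fun=> (i == 0%N)%:R)) => v; rewrite wprod0 coef1.
apply: (@cong_ext _ (fun v => (wprod (a^~ v) n * (1 - (a n.+1 v)%:P * 'X^(n.+1)))`_i) _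
                    (fun v => (wprod (b^~ v) n * (1 - (b n.+1 v)%:P * 'X^(n.+1)))`_i)).
- by move=> v; rewrite wprodS.
- by move=> v; rewrite wprodS.
apply: coef_cong_mul => [||j|j].
- exact: coefD_wprod.
- exact: coefD_factor.
- by apply: IHn => d /andP[d0 dn]; apply: ab; rewrite d0 leqW.
have [|h [Dh hE]] := ab n.+1; first by rewrite leqnn.
exists (fun v => - (j == n.+1)%:R * h v); split; first by apply: D_mul => //; exact: D_const.
by move=> v; rewrite !coefB !coefCM !coefXn hE; ring.
Qed.

(* Newton's recursion for E_n divides by n and loses p-adic precision; passing to the Witt
   coordinates of E avoids the loss. *)
Lemma nu_cong p r E E' : prime p -> (0 < r)%N ->
  (forall n, D (E n)) -> (forall v, E 0%N v = 1) ->
  (forall n, D (E' n)) -> (forall v, E' 0%N v = 1) ->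
  (forall n, (0 < n)%N -> cong (p ^ (r + logn p n)) (fun v => nu (E^~ v) n)
                                                    (fun v => nu (E'^~ v) n)) ->
  forall n, cong (p ^ r) (E n) (E' n).
Proof.
move=> pp r0 DE E0 DE' E'0 nuEE' n.
have [a [Da aE]] := witt_coords DE E0; have [b [Db bE]] := witt_coords DE' E'0.
suff ab d : (0 < d)%N -> cong (p ^ r) (a d) (b d).
  have EE u w v k : (forall v n, (wprod (u^~ v) n)`_n = (-1) ^+ n * w n v) ->
      (-1) ^+ k * (wprod (u^~ v) k)`_k = w k v :> int.
    by move=> ->; rewrite mulrA -exprD addnn -signr_odd odd_double mul1r.
  have [h [Dh hE]] := wprod_cong (n := n) (N := p ^ r) Da Db
    (fun d dn => ab d (proj1 (andP dn))) n.
  exists (fun v => (-1) ^+ n * h v); split; first by apply: D_mul => //; exact: D_const.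
  by move=> v; rewrite -(EE _ a E v n aE) -(EE _ b E' v n bE) hE; ring.
elim/ltn_ind: d => n' IH n0; rename n' into k.
have sumE c (w : nat -> (V -> int) -> int) v : (forall v, w 0%N v = 1) ->
    (forall v n, (wprod (c^~ v) n)`_n = (-1) ^+ n * w n v) ->
    k%:Z * c k v = nu (w^~ v) k - \sum_(1 <= d < k | (d %| k)%N) d%:Z * c d v ^+ (k %/ d).
  move=> w0 cE; rewrite (nu_coords (w0 v) (cE v)) // dsum_recr // divnn n0 expr1; ring.
have [h [Dh hE]] := nuEE' k n0.
have [l [Dl lE]] : cong (p ^ (r + logn p k))
    (fun v => \sum_(1 <= d < k | (d %| k)%N) d%:Z * a d v ^+ (k %/ d))
    (fun v => \sum_(1 <= d < k | (d %| k)%N) d%:Z * b d v ^+ (k %/ d)).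
  (* [cong_sum] asks for the congruence at all divisors, without a bound on the index; the guard
     restricts this to 0 < d < k, where the induction hypothesis is available. *)
  pose f (c : nat -> (V -> int) -> int) (d : nat) v : int :=
    if (0 < d < k)%N then d%:Z * c d v ^+ (k %/ d) else 0.
  have fE (c : nat -> (V -> int) -> int) v :
      \sum_(1 <= d < k | (d %| k)%N) d%:Z * c d v ^+ (k %/ d) =
      \sum_(1 <= d < k | (d %| k)%N) f c d v.
    by rewrite big_nat_cond [RHS]big_nat_cond; apply: eq_bigr => d /andP[dk _]; rewrite /f dk.
  apply: (@cong_ext _ (fun v => \sum_(1 <= d < k | (d %| k)%N) f a d v) _
                      (fun v => \sum_(1 <= d < k | (d %| k)%N) f b d v)).
  - by move=> v; rewrite fE.
  - by move=> v; rewrite fE.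
  apply: cong_sum => d dk; rewrite /f; case: (boolP (0 < d < k)%N) => [/andP[d0 ltdk]|_]; last exact: cong_refl.
  (* The exponent k/d contributes v_p(k/d) and the coefficient d contributes v_p(d). *)
  have [u [Du uE]] := cong_exp_logn (k %/ d) pp r0 (Db d) (IH d ltdk d0).
  have [c dE] : exists c : int, d%:Z = (p ^ logn p d)%N%:Z * c.
    have /dvdnP[j dE] := pfactor_dvdnn p d; exists j%:Z.
    by rewrite -PoszM mulnC -dE.
  exists (fun v => c * u v); split; first by apply: D_mul => //; exact: D_const.
  move=> v; rewrite uE.
  have -> : (p ^ (r + logn p k))%N%:Z =
            (p ^ logn p d)%N%:Z * (p ^ (r + logn p (k %/ d)))%N%:Z.
    by rewrite -PoszM -expnD addnCA -lognM ?dvdn_div_gt0 // mulnC divnK.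
  by rewrite dE; ring.
(* To divide by k = j p^v: j is a unit modulo p^r, and p^v is cancelled in Z against the surplus
   precision. *)
have kE := pfactor_coprime pp n0; case: kE => j cpj kE.
have ckr : coprimez j%:Z (p ^ r)%N%:Z.
  by rewrite /coprimez /gcdz eqz_nat !absz_nat -/(coprime _ _) coprime_sym coprimeXl.
apply: (cong_unit ckr) => //.
exists (fun v => h v - l v); split; first exact: D_sub.
have pk0 : (p ^ logn p k)%N%:Z != 0 by rewrite eqz_nat expn_eq0; case: p pp {nuEE' IH h Dh hE l Dl lE cpj kE ckr}.
move=> v; apply: (mulfI pk0).
have e1 c : (p ^ logn p k)%N%:Z * (j%:Z * c) = k%:Z * c.
  by rewrite mulrA -PoszM mulnC -kE.
rewrite mulrDr !e1 (sumE a E) // (sumE b E') // hE lE expnD PoszM; ring.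
Qed.

End WittCoordinates.

(** * Universal polynomials of lambda-rings *)

Lemma D_zeval (V W : Type) (G : (V -> int) -> W -> int) (p : zexpr W) :
  (forall x, D (fun v => G v x)) -> D (fun v => zeval (G v) p).
Proof.
move=> DG; pose e x := proj1_sig (constructive_indefinite_description _ (DG x)).
exists (zbind e p) => v; rewrite zeval_bind; apply: eq_zeval => x.
by rewrite /e; case: constructive_indefinite_description.
Qed.

Definition frob_std (V : Type) (p : nat) (v : V -> int) (x : V) := v x ^+ p.

Lemma frob_std_lift (V : Type) : frobenius_lift (@frob_std V).
Proof.
split=> [p x|p x _]; first exact: D_exp (D_var x).
exact: cong_refl.
Qed.

Definition cons1 (A : comPzRingType) (e : nat -> A) (i : nat) : A :=
  if i is j.+1 then e j else 1.

Lemma D_cons1 (V : Type) (G : nat -> (V -> int) -> int) i :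
  (forall j, D (G j)) -> D (fun v => cons1 (G^~ v) i).
Proof. by move=> DG; case: i => [|i]; [exact: D_const | exact: DG]. Qed.

(* psi^k lambda^i as a polynomial in the lambda^j, with lambda^(j+1) as variable j *)
Lemma psi_poly_exists : exists Q : nat -> nat -> zexpr nat,
  forall k, (0 < k)%N -> forall v : nat -> int, zeval v (Q k 0%N) = 1 /\
    forall j, (0 < j)%N -> nu (fun i => zeval v (Q k i)) j = nu (cons1 v) (j * k).
Proof.
suff H k : exists Q : nat -> zexpr nat, (0 < k)%N -> forall v : nat -> int,
    zeval v (Q 0%N) = 1 /\
    forall j, (0 < j)%N -> nu (fun i => zeval v (Q i)) j = nu (cons1 v) (j * k).
  pose Q k := proj1_sig (constructive_indefinite_description _ (H k)).
  by exists Q => k k0 v; rewrite /Q; case: constructive_indefinite_description => /= q; apply.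
case: (posnP k) => [->|k0]; first by exists (fun=> ZC nat 0).
have DE n : D (fun v : nat -> int => cons1 v n) by apply: D_cons1 => j; exact: D_var.
have E0 (v : nat -> int) : cons1 v 0 = 1 by [].
have nd := nu_dwork (frob_std_lift nat) DE E0.
have [|p j|E [DE' E'0 nuE']] := @newton_integral nat (@frob_std nat)
    (fun j v => nu (cons1 v) (j * k)) (frob_std_lift nat).
- by move=> j j0; apply: (D_nu DE) => //; rewrite muln_gt0 j0.
(* The power sums of E at index j k satisfy the congruence modulo p^v_p(j k), which is stronger than
   p^v_p(j). *)
- move=> pp j0 pj; have jk0 : (0 < j * k)%N by rewrite muln_gt0 j0.
  have := nd _ _ pp jk0 (dvdn_mulr k pj).
  case: ifP => _; last rewrite divn_mulAC //; apply: cong_dvd;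
    by rewrite dvdn_exp2l // lognM // leq_addr.
pose Q n := proj1_sig (constructive_indefinite_description _ (DE' n)).
have QE n v : zeval v (Q n) = E n v.
  by rewrite /Q; case: constructive_indefinite_description => /= q ->.
exists Q => _ v; split=> [|j j0]; first by rewrite QE.
by rewrite -nuE' //; apply: eq_nu => i _; rewrite QE.
Qed.

Definition psi_poly : nat -> nat -> zexpr nat :=
  proj1_sig (constructive_indefinite_description _ psi_poly_exists).

Definition psi_seq (A : comPzRingType) k (E : nat -> A) (i : nat) : A :=
  zeval (fun j => E j.+1) (psi_poly k i).

Lemma psi_seq0 k (E : nat -> int) : (0 < k)%N -> psi_seq k E 0 = 1.
Proof.
move=> k0; rewrite /psi_seq /psi_poly; case: constructive_indefinite_description => /= Q QP.
by have [] := QP k k0 (fun j => E j.+1).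
Qed.

Lemma nu_psi_seq k j (E : nat -> int) : (0 < k)%N -> (0 < j)%N ->
  nu (psi_seq k E) j = nu E (j * k).
Proof.
move=> k0 j0; have -> : nu E (j * k) = nu (cons1 (fun j => E j.+1)) (j * k).
  by apply: eq_nu => -[].
rewrite /psi_seq /psi_poly; case: constructive_indefinite_description => /= Q QP.
by have [_ ->] := QP k k0 (fun j => E j.+1).
Qed.

(** The first i power sums of [psi_seq k E] are the [nu E (j * k)] with j <= i, which involve E only
    up to i k. Finitely many variables thus suffice for the composition polynomials. *)
Lemma eq_psi_seq (E E' : nat -> int) k i : (0 < k)%N ->
  (forall j, (0 < j <= i * k)%N -> E j = E' j) -> psi_seq k E i = psi_seq k E' i.
Proof.
move=> k0 EE'; apply: (@nu_inj _ _ i) => // [|j /andP[j0 ji]]; first by rewrite !psi_seq0.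
rewrite !nu_psi_seq //; apply: eq_nu => l /andP[l0 lj]; apply: EE'; rewrite l0.
by rewrite (leq_trans lj) // leq_mul2r ji orbT.
Qed.

Lemma psi_seq1 (E : nat -> int) i : E 0%N = 1 -> psi_seq 1 E i = E i.
Proof.
move=> E0; apply: (@nu_inj _ _ i) => // [|j /andP[j0 _]]; first by rewrite psi_seq0.
by rewrite nu_psi_seq // muln1.
Qed.

Lemma psi_seqM j k (E : nat -> int) i : (0 < j)%N -> (0 < k)%N ->
  psi_seq j (psi_seq k E) i = psi_seq (j * k) E i.
Proof.
move=> j0 k0; have jk0 : (0 < j * k)%N by rewrite muln_gt0 j0.
apply: (@nu_inj _ _ i) => // [|l /andP[l0 _]]; first by rewrite !psi_seq0.
by rewrite !nu_psi_seq ?muln_gt0 ?l0 ?j0 ?k0 // mulnA.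
Qed.

Lemma D_psi_seq (V : Type) (E : nat -> (V -> int) -> int) k i :
  (forall n, D (E n)) -> D (fun v => psi_seq k (E^~ v) i).
Proof. by move=> DE; apply: D_zeval => j. Qed.

(** For m = 0 the criterion is always in its second case. *)
Lemma prime_ndvdN1 (p : nat) : prime p -> (p%:Z %| (0 - 1)%R)%Z = false.
Proof.
by move=> pp; apply/negbTE; rewrite sub0r rpredN dvdz1 /= neq_ltn prime_gt1 ?orbT.
Qed.

(** By [nu_cong] with r = v_p(k) it suffices to compare power sums. The j-th one is [nu E (j * k)],
    known modulo p^v_p(j k), and v_p(j k) = r + v_p(j) is the precision required. *)
Lemma psi_seq_dwork (V : Type) F (E : nat -> (V -> int) -> int) n : frobenius_lift F ->
  (forall n, D (E n)) -> (forall v, E 0%N v = 1) -> dwork 0 F (fun k v => psi_seq k (E^~ v) n).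
Proof.
move=> FL DE E0 p k pp k0 pk; have kp0 := dvdn_div_gt0 k0 pk.
rewrite prime_ndvdN1 //.
have [DF _] := FL.
pose E1 i v := psi_seq k (E^~ v) i.
pose E2 i v := psi_seq (k %/ p) (fun l => E l (F p v)) i.
apply: (@nu_cong V p (logn p k) E1 E2) => //.
- by rewrite logn_gt0 mem_primes pp k0.
- by move=> i; apply: D_psi_seq.
- by move=> v; apply: psi_seq0.
- move=> i; apply: (@D_psi_seq V (fun l v => E l (F p v))) => l.
  by apply: D_comp (DE l).
- by move=> v; apply: psi_seq0.
move=> j j0; have jk0 : (0 < j * k)%N by rewrite muln_gt0 j0.
have := nu_dwork FL DE E0 pp jk0 (dvdn_mull j pk).
rewrite prime_ndvdN1 //.
rewrite lognM // addnC -muln_divA //; apply: cong_ext => v; first by rewrite /E1 nu_psi_seq.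
by rewrite /E2 nu_psi_seq.
Qed.

Lemma psi_seq_cong (p i : nat) : prime p ->
  cong p (fun v : nat -> int => psi_seq p (cons1 v) i) (fun v => cons1 v i ^+ p).
Proof.
move=> pp; have p0 := prime_gt0 pp; have p1 := prime_gt1 pp.
have DE n : D (fun v : nat -> int => cons1 v n) by apply: D_cons1 => j; exact: D_var.
have dw := @psi_seq_dwork nat (@frob_std nat) (fun n v => cons1 v n) i
  (frob_std_lift nat) DE (fun=> erefl).
have := dw p p pp p0 (dvdnn p).
rewrite prime_ndvdN1 //.
rewrite (logn_prime _ pp) eqxx expn1 divnn p0; apply: cong_ext => v //.
by rewrite psi_seq1 //; case: i {dw} => [|i]; rewrite /= ?expr1n.
Qed.

(* Variable [o : 'I_N] stands for index [o.+1]; entries beyond [N] are set to 0, which does not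
   affect power sums up to [N]. *)
Definition trunc1 (N : nat) (e : 'I_N -> int) (i : nat) : int :=
  if i is j.+1 then (if insub j is Some o then e o else 0) else 1.

Lemma trunc1E N (E : nat -> int) i : (0 < i <= N)%N -> trunc1 (fun o : 'I_N => E o.+1) i = E i.
Proof. by case: i => // i /= iN; rewrite insubT. Qed.

Lemma D_trunc1 (V : Type) N (f : 'I_N -> V) i :
  D (fun v : V -> int => trunc1 (fun o => v (f o)) i).
Proof.
case: i => [|i] /=; first exact: D_const.
by case: insub => [o|]; [exact: D_var | exact: D_const].
Qed.

(** The power sums of the lambda-series of a product are products of power sums; these satisfy the
    criterion, so the way back to coefficients is integral. *)
Lemma lam_mul_poly_exists n : exists P : zexpr (bool * 'I_n), forall E E' F : nat -> int,
  F 0%N = 1 -> (forall k, (0 < k <= n)%N -> nu F k = nu E k * nu E' k) ->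
  zeval (fun x : bool * 'I_n => (if x.1 then E else E') x.2.+1) P = F n.
Proof.
pose G b i (v : bool * 'I_n -> int) := trunc1 (fun o => v (b, o)) i.
have DG b i : D (G b i) by exact: D_trunc1.
have G0 b v : G b 0%N v = 1 by [].
have FL := frob_std_lift (bool * 'I_n).
have Dnu b k : (0 < k)%N -> D (fun v => nu (fun i => G b i v) k).
  by move=> k0; apply: D_nu.
have [|H [DH H0 nuH]] := newton_integral FL _
  (dworkM (proj1 FL) (Dnu true) (Dnu false) (nu_dwork FL (DG true) (G0 true))
     (nu_dwork FL (DG false) (G0 false))).
  by move=> k k0; apply: D_mul; apply: Dnu.
have [P PE] := DH n; exists P => E E' F F0 nuF.
rewrite -PE; set v := fun x => _; apply: (@nu_inj (H^~ v) F n) => [|k kn|//].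
  by rewrite H0 F0.
have /andP[k0 _] := kn; rewrite nuH // nuF //; congr (_ * _); apply: eq_nu => i /andP[i0 ik].
  by rewrite /G (@trunc1E n E) // i0 (leq_trans ik) //; case/andP: kn.
by rewrite /G (@trunc1E n E') // i0 (leq_trans ik) //; case/andP: kn.
Qed.

Definition lam_mul_poly n : zexpr (bool * 'I_n) :=
  proj1_sig (constructive_indefinite_description _ (lam_mul_poly_exists n)).

Lemma lam_mul_polyP n (E E' F : nat -> int) :
  F 0%N = 1 -> (forall k, (0 < k <= n)%N -> nu F k = nu E k * nu E' k) ->
  zeval (fun x : bool * 'I_n => (if x.1 then E else E') x.2.+1) (lam_mul_poly n) = F n.
Proof. by rewrite /lam_mul_poly; case: constructive_indefinite_description => P /=; apply. Qed.

(** The k-th power sum of the lambda-series of lambda^n(x) is psi^k(lambda^n(x)), here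
    [psi_seq k E n]; its congruences in k give integrality. *)
Lemma lam_comp_poly_exists m n : exists P : zexpr 'I_(m * n), forall E F : nat -> int,
  F 0%N = 1 -> (forall k, (0 < k <= m)%N -> nu F k = psi_seq k E n) ->
  zeval (fun i : 'I_(m * n) => E i.+1) P = F m.
Proof.
pose G i (v : 'I_(m * n) -> int) := trunc1 v i.
have DG i : D (G i) by exact: (@D_trunc1 _ _ id).
have G0 v : G 0%N v = 1 by [].
have FL := frob_std_lift 'I_(m * n).
have [|H [DH H0 nuH]] := newton_integral FL _ (psi_seq_dwork n FL DG G0).
  by move=> k k0; apply: D_psi_seq.
have [P PE] := DH m; exists P => E F F0 nuF.
rewrite -PE; set v := fun x => _; apply: (@nu_inj (H^~ v) F m) => [|k kn|//].
  by rewrite H0 F0.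
have /andP[k0 km] := kn; rewrite nuH // nuF //; apply: eq_psi_seq => // i /andP[i0 ik].
by rewrite /G (@trunc1E (m * n) E) // i0 (leq_trans ik) // mulnC leq_mul2r km orbT.
Qed.

Definition lam_comp_poly m n : zexpr 'I_(m * n) :=
  proj1_sig (constructive_indefinite_description _ (lam_comp_poly_exists m n)).

Lemma lam_comp_polyP m n (E F : nat -> int) :
  F 0%N = 1 -> (forall k, (0 < k <= m)%N -> nu F k = psi_seq k E n) ->
  zeval (fun i : 'I_(m * n) => E i.+1) (lam_comp_poly m n) = F m.
Proof. by rewrite /lam_comp_poly; case: constructive_indefinite_description => P /=; apply. Qed.

Lemma eq_esymF (I : finType) (A : comPzRingType) (z w : I -> A) :
  z =1 w -> esymF z =1 esymF w.
Proof. by move=> zw i; apply: eq_bigr => S _; apply: eq_bigr => j _. Qed.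

Lemma pfun_esymF (V : Type) (I : finType)
    (z : I -> forall A : comPzRingType, (V -> A) -> A) i :
  (forall j, pfun (z j)) -> pfun (fun A v => esymF (fun j => z j A v) i).
Proof.
move=> pz; apply: (@pfun_sum V _ (index_enum {set I}) (fun S => #|S| == i)
  (fun S A v => \prod_(j in S) z j A v)) => S _.
exact: (@pfun_prod V _ (index_enum I) (fun j => j \in S) z).
Qed.

Lemma lam_mul_poly_spec n : lam_mul_spec (lam_mul_poly n).
Proof.
move=> A x y; pose v (u : bool * 'I_n) := if u.1 then x u.2 else y u.2.
pose f (B : comPzRingType) (w : bool * 'I_n -> B) :=
  zeval (fun u : bool * 'I_n => esymF (fun i => w (u.1, i)) u.2.+1) (lam_mul_poly n).
pose g (B : comPzRingType) (w : bool * 'I_n -> B) :=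
  esymF (fun p => w (true, p.1) * w (false, p.2)) n.
transitivity (f A v); first by apply: eq_zeval => -[[] i].
transitivity (g A v); last by [].
apply: (@pfun_int_eq _ f g).
- apply: pfun_zeval => u; apply: (@pfun_esymF _ _ (fun i B w => w (u.1, i))) => i.
  exact: pfun_var.
- apply: (@pfun_esymF _ _ (fun p B w => w (true, p.1) * w (false, p.2))) => p.
  by apply: pfunM; exact: pfun_var.
move=> w; rewrite /f /g.
rewrite -(@lam_mul_polyP n (esymF (fun i => w (true, i))) (esymF (fun i => w (false, i)))).
- by apply: eq_zeval => -[[] i].
- exact: esymF0.
move=> k /andP[k0 _]; rewrite !nu_esymF // big_distrlr /= pair_big /=.
by apply: eq_bigr => p _; rewrite exprMn.
Qed.

Lemma psi_seq_esymF (I : finType) (z : I -> int) k i : (0 < k)%N ->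
  psi_seq k (esymF z) i = esymF (fun j => z j ^+ k) i.
Proof.
move=> k0; apply: (@nu_inj _ _ i) => // [|l /andP[l0 _]]; first by rewrite psi_seq0 // esymF0.
rewrite nu_psi_seq // !nu_esymF ?muln_gt0 ?l0 //; apply: eq_bigr => j _.
by rewrite -exprM mulnC.
Qed.

Lemma lam_comp_poly_spec m n : lam_comp_spec (lam_comp_poly m n).
Proof.
(* Subsets of the wrong size receive the value 0: the index type becomes all subsets, and the
   elementary symmetric functions are those of the products over n-subsets. *)
move=> A x; pose z (B : comPzRingType) (w : 'I_(m * n) -> B) (T : {set 'I_(m * n)}) :=
  if #|T| == n then \prod_(i in T) w i else 0.
pose f (B : comPzRingType) (w : 'I_(m * n) -> B) :=
  zeval (fun i : 'I_(m * n) => esymF w i.+1) (lam_comp_poly m n).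
pose g (B : comPzRingType) (w : 'I_(m * n) -> B) := esymF (z B w) m.
transitivity (f A x); first by [].
transitivity (g A x); last first.
  rewrite /g /esymF (bigID (fun U : {set {set 'I_(m * n)}} => [forall T in U, #|T| == n])) /=.
  rewrite [X in _ + X]big1 ?addr0 => [|U /andP[_]].
    apply: eq_bigr => U /andP[_ /forall_inP Un]; apply: eq_bigr => T TU.
    by rewrite /z Un.
  rewrite negb_forall => /existsP[T]; rewrite negb_imply => /andP[TU nT].
  by rewrite (bigD1 T) //= /z (negbTE nT) mul0r.
apply: (@pfun_int_eq _ f g).
- apply: pfun_zeval => i; apply: (@pfun_esymF _ _ (fun i B w => w i)) => j.
  exact: pfun_var.
- apply: (@pfun_esymF _ _ (fun T B w => z B w T)) => T.
  rewrite /z; case: (boolP (#|T| == n)) => _; last exact: pfun0.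
  apply: (@pfun_prod _ _ (index_enum 'I_(m * n)) (fun i => i \in T) (fun i B w => w i)) => j _.
  exact: pfun_var.
move=> w; rewrite /f /g; apply: lam_comp_polyP; first exact: esymF0.
move=> k /andP[k0 _]; rewrite nu_esymF // psi_seq_esymF // /esymF [RHS]big_mkcond /=.
by apply: eq_bigr => T _; rewrite /z; case: ifP => _; rewrite ?prodrXl // expr0n eqn0Ngt k0.
Qed.

(** * Arithmetic of Lambda(Z) *)

Lemma int_newton_integral (g : nat -> int) :
  dwork 0 (@frob_std unit) (fun n _ => g n) ->
  exists F : nat -> int, F 0%N = 1 /\ forall k, (0 < k)%N -> nu F k = g k.
Proof.
move=> dg; have [|E [_ E0 nuE]] := newton_integral (frob_std_lift unit) _ dg.
  by move=> n _; exact: D_const.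
by exists (fun n => E n (fun=> 0)); split=> [|k k0]; [exact: E0 | exact: nuE].
Qed.

Definition seq_mul (A : comPzRingType) (E E' : nat -> A) (n : nat) : A :=
  zeval (fun x : bool * 'I_n => (if x.1 then E else E') x.2.+1) (lam_mul_poly n).

Lemma seq_mul_spec (E E' : nat -> int) : E 0%N = 1 -> E' 0%N = 1 ->
  seq_mul E E' 0 = 1 /\ forall k, (0 < k)%N -> nu (seq_mul E E') k = nu E k * nu E' k.
Proof.
move=> E0 E'0; have FL := frob_std_lift unit.
have cD (e : nat -> int) n : D (fun _ : unit -> int => e n) by exact: D_const.
have [|F [F0 nuF]] := @int_newton_integral (fun k => nu E k * nu E' k).
  apply: (@dworkM _ _ _ (proj1 FL) (fun n _ => nu E n) (fun n _ => nu E' n)) => //.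
    exact: (nu_dwork FL (cD E) (fun=> E0)).
  exact: (nu_dwork FL (cD E') (fun=> E'0)).
have mF n : seq_mul E E' n = F n by apply: lam_mul_polyP => // k /andP[k0 _]; exact: nuF.
by split=> [|k k0]; [rewrite mF | rewrite -nuF //; apply: eq_nu => i _].
Qed.

Lemma int_comp_seq (E : nat -> int) i : E 0%N = 1 ->
  exists F : nat -> int, F 0%N = 1 /\ forall k, (0 < k)%N -> nu F k = psi_seq k E i.
Proof.
move=> E0; apply: int_newton_integral.
apply: (psi_seq_dwork (E := fun n _ => E n) i (frob_std_lift unit)) => // n.
exact: D_const.
Qed.

(** These are the series 1, 1 + t and 1/(1 + t), the values of lambda_t at 0, 1 and -1;
    [const_seq c] is (1 + t)^c. *)
Definition trivial_seq (i : nat) : int := (i == 0%N)%:R.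
Definition one_seq (i : nat) : int := (i <= 1)%N%:R.
Definition opp_seq (i : nat) : int := (-1) ^+ i.

Definition const_seq (c : int) : nat -> int :=
  match c with
  | Posz n => iter n (conv one_seq) trivial_seq
  | Negz n => iter n.+1 (conv opp_seq) trivial_seq
  end.

Lemma nu_trivial_seq k : (0 < k)%N -> nu trivial_seq k = 0.
Proof.
move=> k0; rewrite nuE // big_nat_cond big1 => [|i /andP[/andP[i0 _] _]].
  by case: k k0 => // k _; rewrite /trivial_seq mulr0 addr0.
by case: i i0 => // i _; rewrite /trivial_seq mulr0 mul0r.
Qed.

Lemma nu_one_seq k : (0 < k)%N -> nu one_seq k = 1.
Proof.
elim: k => // -[|k] IHk _; first by rewrite nu1.
rewrite nuE // big_ltn // subSS subn0 IHk // big_nat_cond big1 => [|i /andP[/andP[i1 _] _]].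
  by rewrite /one_seq /= mulr0 !addr0 sqrrN expr1n !mulr1.
by case: i i1 => [|[|i]] // _; rewrite /one_seq /= mulr0 mul0r.
Qed.

Lemma conv_one_opp n : conv one_seq opp_seq n = trivial_seq n.
Proof.
case: n => [|n]; first by rewrite conv0.
rewrite /conv !big_ord_recl big1 => [|i _]; last by rewrite !lift0 mul0r.
rewrite !lift0 subn0 subSS subn0 /one_seq /opp_seq /= exprS.
by rewrite (_ : trivial_seq n.+1 = 0) //; ring.
Qed.

Lemma nu_opp_seq k : (0 < k)%N -> nu opp_seq k = -1.
Proof.
move=> k0; have /(_ k k0) : forall k, (0 < k)%N -> nu (conv one_seq opp_seq) k = 0.
  by move=> l l0; rewrite -(nu_trivial_seq l0); apply: eq_nu => i _; exact: conv_one_opp.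
by rewrite nu_conv // nu_one_seq // addrC => /eqP; rewrite addr_eq0 => /eqP.
Qed.

Lemma iter_conv0 (E : nat -> int) n : E 0%N = 1 -> iter n (conv E) trivial_seq 0 = 1.
Proof. by move=> E0; elim: n => //= n IHn; rewrite conv0 E0 IHn. Qed.

Lemma const_seq0 c : const_seq c 0 = 1.
Proof. by case: c => n; apply: iter_conv0. Qed.

Lemma nu_iter_conv (E : nat -> int) n k : E 0%N = 1 -> (0 < k)%N ->
  nu (iter n (conv E) trivial_seq) k = n%:Z * nu E k.
Proof.
move=> E0 k0; elim: n => [|n IHn]; first by rewrite nu_trivial_seq // mul0r.
by rewrite iterS nu_conv ?iter_conv0 // IHn intS mulrDl mul1r.
Qed.

Lemma nu_const_seq c k : (0 < k)%N -> nu (const_seq c) k = c.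
Proof.
move=> k0; case: c => n; rewrite /const_seq nu_iter_conv //.
  by rewrite nu_one_seq // mulr1.
by rewrite nu_opp_seq // mulrN1 NegzE.
Qed.

(* Evaluation of [p] in the ring Lambda(A) = 1 + t A[[t]], at the series with coefficients [E x]. *)
Fixpoint lam_eval (V : Type) (A : comPzRingType) (E : V -> nat -> A) (p : zexpr V) : nat -> A :=
  match p with
  | ZV x => E x
  | ZC c => fun i => (const_seq c i)%:~R
  | ZAdd p q => conv (lam_eval E p) (lam_eval E q)
  | ZMul p q => seq_mul (lam_eval E p) (lam_eval E q)
  end.

Lemma lam_eval_spec (V : Type) (E : V -> nat -> int) p : (forall x, E x 0%N = 1) ->
  lam_eval E p 0 = 1 /\
  forall k, (0 < k)%N -> nu (lam_eval E p) k = zeval (fun x => nu (E x) k) p.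
Proof.
move=> E0; elim: p => [x|c|p [p0 IHp] q [q0 IHq]|p [p0 IHp] q [q0 IHq]] /=.
- by split.
- split=> [|k k0]; first by rewrite const_seq0.
  by rewrite intz -[RHS](nu_const_seq c k0); apply: eq_nu => i _; rewrite intz.
- split=> [|k k0]; first by rewrite conv0 p0 q0 mulr1.
  by rewrite nu_conv // IHp // IHq.
- have [m0 mnu] := seq_mul_spec p0 q0; split=> // k k0.
  by rewrite mnu // IHp // IHq.
Qed.

Lemma pfun_nu (V : Type) (E : nat -> forall A : comPzRingType, (V -> A) -> A) k :
  (forall i, pfun (E i)) -> pfun (fun A v => nu (fun i => E i A v) k).
Proof.
move=> pE; elim/ltn_ind: k => -[_|k IHk]; first exact: pfun0.
pose f (A : comPzRingType) (v : V -> A) := \sum_(1 <= i < k.+1) ((-1 : int) ^+ i.+1)%:~R *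
   E i A v * nu (fun i => E i A v) (k.+1 - i) +
   ((-1 : int) ^+ k.+2 * k.+1%:R)%:~R * E k.+1 A v.
have [p pP] : pfun f.
  apply: pfunD; last by apply: pfunM => //; exact: pfun_const.
  (* The guard provides i > 0, so that k + 1 - i is smaller than k + 1 and the induction hypothesis
     applies. *)
  pose h i (A : comPzRingType) (v : V -> A) := if (0 < i)%N then ((-1 : int) ^+ i.+1)%:~R *
     E i A v * nu (fun i => E i A v) (k.+1 - i) else 0.
  have [p pP] : pfun (fun A v => \sum_(1 <= i < k.+1) h i A v).
    apply: (@pfun_sum _ _ _ xpredT h) => i _; rewrite /h; case: (posnP i) => [_|i0].
      exact: pfun0.
    apply: pfunM; last by apply: IHk; rewrite ltn_subrL i0.
    by apply: pfunM => //; exact: pfun_const.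
  exists p => A v; rewrite -pP; apply: eq_big_nat => i /andP[i0 _].
  by rewrite /h i0.
exists p => A v; rewrite -pP nuE // /f rmorphM rmorph_sign rmorph_nat; congr (_ + _).
by apply: eq_bigr => i _; rewrite rmorph_sign.
Qed.

Lemma pfun_conv (V : Type) (E E' : nat -> forall A : comPzRingType, (V -> A) -> A) n :
  (forall i, pfun (E i)) -> (forall i, pfun (E' i)) ->
  pfun (fun A v => conv (fun i => E i A v) (fun i => E' i A v) n).
Proof.
move=> pE pE'.
apply: (@pfun_sum V _ (index_enum 'I_n.+1) xpredT (fun i A v => E i A v * E' (n - i)%N A v)).
by move=> i _; apply: pfunM.
Qed.

Lemma pfun_seq_mul (V : Type) (E E' : nat -> forall A : comPzRingType, (V -> A) -> A) n :
  (forall i, pfun (E i)) -> (forall i, pfun (E' i)) ->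
  pfun (fun A v => seq_mul (fun i => E i A v) (fun i => E' i A v) n).
Proof.
move=> pE pE'.
have [p pP] := pfun_zeval (g := fun (x : bool * 'I_n) => (if x.1 then E else E') x.2.+1)
  (lam_mul_poly n) (fun x => match x with (true, i) => pE i.+1 | (false, i) => pE' i.+1 end).
by exists p => A v; rewrite -pP; apply: eq_zeval => -[[] i].
Qed.

Lemma pfun_lam_eval (V W : Type) (E : V -> nat -> forall A : comPzRingType, (W -> A) -> A) p i :
  (forall x i, pfun (E x i)) -> pfun (fun A v => lam_eval (fun x j => E x j A v) p i).
Proof.
move=> pE; elim: p i => [x|c|p IHp q IHq|p IHp q IHq] i /=.
- exact: pE.
- exact: pfun_const.
- exact: (pfun_conv _ IHp IHq).
- exact: (pfun_seq_mul _ IHp IHq).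
Qed.

Lemma pfun_psi_seq (V : Type) (E : nat -> forall A : comPzRingType, (V -> A) -> A) k i :
  (forall j, pfun (E j)) -> pfun (fun A v => psi_seq k (fun j => E j A v) i).
Proof. by move=> pE; apply: pfun_zeval => j. Qed.

Lemma pfun_cons1 (V : Type) (e : nat -> V) i : pfun (fun A v => cons1 (fun j => v (e j) : A) i).
Proof. by case: i => [|i]; [exact: pfun1 | exact: pfun_var]. Qed.

(** * Adams operations in a lambda-ring *)

Lemma eq_conv (A : comPzRingType) (E E' G G' : nat -> A) : E =1 E' -> G =1 G' ->
  conv E G =1 conv E' G'.
Proof. by move=> EE GG n; apply: eq_bigr => i _; rewrite EE GG. Qed.

Lemma conv_intr (A : comPzRingType) (E E' : nat -> int) n :
  conv (fun i => (E i)%:~R : A) (fun i => (E' i)%:~R) n = (conv E E' n)%:~R.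
Proof. by rewrite /conv rmorph_sum; apply: eq_bigr => i _; rewrite rmorphM. Qed.

Section LambdaRing.
Variables (R : comPzRingType) (lam : nat -> R -> R).
Hypothesis lamP : is_lambda_ring lam.

Lemma lam0 r : lam 0 r = 1.
Proof. by case: lamP => -[]. Qed.

Lemma lam1 r : lam 1 r = r.
Proof. by case: lamP => -[]. Qed.

Lemma lamD n r s : lam n (r + s) = conv (lam^~ r) (lam^~ s) n.
Proof. by case: lamP. Qed.

Lemma lamM n r s : lam n (r * s) = seq_mul (lam^~ r) (lam^~ s) n.
Proof.
case: lamP => _ _ _ /(_ n _ (@lam_mul_poly_spec n) r s) -> _.
by apply: eq_zeval => -[[] i].
Qed.

Lemma lam_lam m n r : lam m (lam n r) = zeval (fun i : 'I_(m * n) => lam i.+1 r) (lam_comp_poly m n).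
Proof. by case: lamP => _ _ _ _; apply; exact: lam_comp_poly_spec. Qed.

Lemma lam_one i : lam i 1 = (one_seq i)%:~R.
Proof.
case: i => [|[|i]]; first exact: lam0; first exact: lam1.
by case: lamP => _ -> .
Qed.

Lemma conv_ends (E E' : nat -> R) n :
  conv E E' n.+1 = E 0%N * E' n.+1 + \sum_(i < n) E i.+1 * E' (n - i)%N + E n.+1 * E' 0%N.
Proof.
by rewrite /conv big_ord_recl big_ord_recr /= subn0 subnn addrA; congr (_ + _ + _).
Qed.

Lemma lam_zero i : lam i 0 = (trivial_seq i)%:~R.
Proof.
elim/ltn_ind: i => -[_|i IHi]; first exact: lam0.
have := lamD i.+1 0 0; rewrite addr0 conv_ends !lam0 mul1r mulr1.
rewrite big1 => [|j _]; last by rewrite IHi ?mul0r // ltnS.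
by rewrite addr0 -[LHS]addr0 => /addrI <-.
Qed.

(** Forced by lambda_t(1) lambda_t(-1) = lambda_t(0) = 1 with lambda_t(1) = 1 + t. *)
Lemma lam_opp1 i : lam i (-1) = (opp_seq i)%:~R.
Proof.
elim: i => [|i IHi]; first exact: lam0.
have := lamD i.+1 1 (-1); rewrite subrr lam_zero /conv !big_ord_recl big1 => [|j _].
  rewrite !lift0 lam0 lam1 subn0 subSS subn0 !mul1r addr0 IHi => /esym/eqP.
  by rewrite addr_eq0 => /eqP ->; rewrite /opp_seq exprS mulN1r rmorphN.
by rewrite !lift0 lam_one mul0r.
Qed.

Lemma lam_iter_conv (r : R) (E : nat -> int) n i : (forall i, lam i r = (E i)%:~R) ->
  lam i (r *+ n) = (iter n (conv E) trivial_seq i)%:~R.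
Proof.
move=> rE; elim: n i => [|n IHn] i; first by rewrite mulr0n lam_zero.
by rewrite mulrS lamD iterS -conv_intr; apply: eq_conv.
Qed.

Lemma lam_const c i : lam i c%:~R = (const_seq c i)%:~R.
Proof.
case: c => n; rewrite /const_seq.
  exact: (lam_iter_conv _ _ lam_one).
by rewrite NegzE rmorphN -mulNrn; apply: (lam_iter_conv _ _ lam_opp1).
Qed.

Lemma lam_zeval (V : Type) (v : V -> R) p i :
  lam i (zeval v p) = lam_eval (fun x => lam^~ (v x)) p i.
Proof.
elim: p i => [x|c|p IHp q IHq|p IHp q IHq] i //=.
- exact: lam_const.
- by rewrite lamD; apply: eq_conv.
- rewrite lamM; apply: eq_zeval => -[[] j] /=; [exact: IHp | exact: IHq].
Qed.

Lemma adams_zeval (V : eqType) (v : V -> R) p k : (0 < k)%N ->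
  adams lam k (zeval v p) = zeval (fun x => adams lam k (v x)) p.
Proof.
move=> k0.
(* [cons1] makes E_0 = 1 hold for every valuation, as the identities over Z require, and leaves the
   other entries free. *)
pose E x i (A : comPzRingType) (w : V * nat -> A) := cons1 (fun j => w (x, j)) i.
have pE x i : pfun (E x i) by exact: pfun_cons1.
pose f A w := nu (fun i => lam_eval (fun x j => E x j A w) p i) k.
pose g A w := zeval (fun x => nu (fun j => E x j A w) k) p.
pose w (x : V * nat) := lam x.2.+1 (v x.1).
have Ew x i : (0 < i)%N -> E x i R w = lam i (v x) by case: i.
have Ew' x : E x ^~ R ^~ w =1 lam^~ (v x) by case=> [|i] //; rewrite lam0.
transitivity (f R w).
  rewrite adams_nu; apply: eq_nu => i _; rewrite lam_zeval.
  by congr lam_eval; apply: functional_extensionality => x; apply: functional_extensionality => j; rewrite Ew'.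
transitivity (g R w); last first.
  by apply: eq_zeval => x; rewrite adams_nu; apply: eq_nu => i _; rewrite Ew'.
apply: (@pfun_int_eq _ f g).
- by apply: pfun_nu => i; apply: pfun_lam_eval.
- by apply: pfun_zeval => x; apply: pfun_nu.
by move=> u; have [_ nuE] := @lam_eval_spec _ (fun x j => E x j int u) p (fun=> erefl); exact: nuE.
Qed.

(** The composition axiom writes lambda^j(lambda^i r) by [lam_comp_poly]; over Z these values form
    the sequence whose k-th power sum is [psi_seq k E i]. *)
Lemma adams_lam k i r : (0 < k)%N -> adams lam k (lam i r) = psi_seq k (lam^~ r) i.
Proof.
move=> k0; pose E i (A : comPzRingType) (w : nat -> A) := cons1 w i.
have pE j : pfun (E j) by exact: (@pfun_cons1 _ id).
pose f A w := nu (fun j => zeval (fun l : 'I_(j * i) => E l.+1 A w) (lam_comp_poly j i)) k.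
pose g A w := psi_seq k (fun j => E j A w) i.
pose w j := lam j.+1 r.
transitivity (f R w); first by rewrite adams_nu; apply: eq_nu => j _; rewrite lam_lam.
transitivity (g R w); last by [].
apply: (@pfun_int_eq _ f g).
- by apply: pfun_nu => j; apply: pfun_zeval.
- exact: pfun_psi_seq.
move=> u; have [F [F0 nuF]] := @int_comp_seq (cons1 u) i erefl.
rewrite /g -nuF //; apply: eq_nu => j _; apply: lam_comp_polyP => // l /andP[l0 _].
exact: nuF.
Qed.

End LambdaRing.

(** * Integrality of the polynomials S, P and M *)

Lemma D_zexprs (V : Type) (a : nat -> (V -> int) -> int) : (forall d, D (a d)) ->
  exists S : nat -> zexpr V, forall d v, zeval v (S d) = a d v.
Proof.
move=> Da; pose S d := proj1_sig (constructive_indefinite_description _ (Da d)).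
by exists S => d v; rewrite /S; case: constructive_indefinite_description => /= p ->.
Qed.

Lemma power_zexpr_exists (V : Type) (m : int) (g : nat -> (V -> int) -> int) :
  (forall n, (0 < n)%N -> D (g n)) -> dwork m (@frob_std V) g ->
  exists S : nat -> zexpr V, forall n v, (0 < n)%N ->
    \dsum_(d | n) (wc m n d)%:~R * zeval v (S d) ^+ (n %/ d) = g n v.
Proof.
move=> Dg dg; have [a [Da aE]] := power_dwork_exists (frob_std_lift V) Dg dg.
have [S SE] := D_zexprs Da; exists S => n v n0; rewrite -aE //.
by apply: eq_bigr => d _; rewrite intz SE.
Qed.

Definition power_sum (V : Type) m (e : nat -> V) n (v : V -> int) : int :=
  \dsum_(d | n) wc m n d * v (e d) ^+ (n %/ d).

Lemma power_sum_dwork (V : Type) m (e : nat -> V) :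
  (forall n, D (power_sum m e n)) /\ dwork m (@frob_std V) (power_sum m e).
Proof.
split; last by apply: (power_dwork m (frob_std_lift V) (a := fun d v => v (e d))) => d; exact: D_var.
move=> n; apply: D_sum => d _; apply: D_mul; first exact: D_const.
by apply: D_exp; exact: D_var.
Qed.

Lemma pfun_dsum (V : Type) n (c : nat -> int)
    (f : nat -> forall A : comPzRingType, (V -> A) -> A) :
  (forall d, pfun (f d)) -> pfun (fun A v => \dsum_(d | n) (c d)%:~R * f d A v).
Proof.
move=> pf; apply: (@pfun_sum V _ (index_iota 1 n.+1) (fun d => (d %| n)%N)
  (fun d A v => (c d)%:~R * f d A v)) => d _.
by apply: pfunM => //; exact: pfun_const.
Qed.

Lemma pfun_expr (V : Type) (p : zexpr V) : pfun (fun A v => zeval v p).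
Proof. by exists p. Qed.

Lemma WS_exists m : exists S, WS_spec m S.
Proof.
have [D1 d1] := power_sum_dwork m (fun d : nat => (true, d)).
have [D2 d2] := power_sum_dwork m (fun d : nat => (false, d)).
have [|S SE] := power_zexpr_exists _ (dworkD d1 d2).
  by move=> n _; apply: D_add.
exists S => A v n n0.
pose f (A : comPzRingType) (v : bool * nat -> A) :=
  \dsum_(d | n) (wc m n d)%:~R * zeval v (S d) ^+ (n %/ d).
pose g (A : comPzRingType) (v : bool * nat -> A) :=
  \dsum_(d | n) (wc m n d)%:~R * (v (true, d) ^+ (n %/ d) + v (false, d) ^+ (n %/ d)).
apply: (@pfun_int_eq _ f g) => [||w].
- by apply: (pfun_dsum n (wc m n)) => d; apply: pfunX; exact: pfun_expr.
- apply: (pfun_dsum n (wc m n)) => d.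
  by apply: pfunD; apply: pfunX; exact: pfun_var.
rewrite /f SE // /power_sum /g -big_split; apply: eq_bigr => d _ /=.
by rewrite intz mulrDr.
Qed.

Lemma WP_exists m : exists P, WP_spec m P.
Proof.
have [D1 d1] := power_sum_dwork m (fun d : nat => (true, d)).
have [D2 d2] := power_sum_dwork m (fun d : nat => (false, d)).
have DF := proj1 (frob_std_lift (bool * nat)).
have [|S SE] := power_zexpr_exists _
  (dworkZ (1 - m) (dworkM DF (fun n _ => D1 n) (fun n _ => D2 n) d1 d2)).
  by move=> n _; apply: D_mul; [exact: D_const | exact: D_mul].
exists S => A v n n0.
pose f (A : comPzRingType) (v : bool * nat -> A) :=
  \dsum_(d | n) (wc m n d)%:~R * zeval v (S d) ^+ (n %/ d).
pose h b (A : comPzRingType) (v : bool * nat -> A) :=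
  \dsum_(d | n) (wc m n d)%:~R * v (b, d) ^+ (n %/ d).
pose g (A : comPzRingType) (v : bool * nat -> A) := (1 - m)%:~R * h true A v * h false A v.
apply: (@pfun_int_eq _ f g) => [||w].
- by apply: (pfun_dsum n (wc m n)) => d; apply: pfunX; exact: pfun_expr.
- have ph b : pfun (h b).
    by apply: (pfun_dsum n (wc m n)) => d; apply: pfunX; exact: pfun_var.
  by apply: pfunM => //; apply: pfunM => //; exact: pfun_const.
rewrite /f SE // /g intz -mulrA; congr (_ * (_ * _)).
  by apply: eq_bigr => d _; rewrite intz.
by apply: eq_bigr => d _; rewrite intz.
Qed.

Lemma psivK1 x : psiv 1 x = x.
Proof. by case: x => -[b k] d; rewrite /psiv mul1n. Qed.

Lemma psivM j k x : psiv j (psiv k x) = psiv (j * k) x.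
Proof. by rewrite /psiv /= mulnA. Qed.

(** The Psi^k x_d are independent variables, so substituting Psi^p lifts no Frobenius. The criterion
    applies nevertheless, because Psi^k = Psi^(k/p) Psi^p holds exactly. *)
Lemma BP_exists m : exists P, BP_spec m P.
Proof.
pose V := (bool * nat * nat)%type.
pose F k (v : V -> int) x := v (psiv k x).
pose theta k (f : (V -> int) -> int) v := f (F k v).
have DF k x : D (fun v => F k v x) by exact: D_var.
have Dth k f : D f -> D (theta k f) by exact: D_comp.
have th1 f v : D f -> theta 1%N f v = f v.
  move=> _; congr (f _); apply: functional_extensionality => x.
  by rewrite /F psivK1.
have thF p k f : prime p -> (0 < k)%N -> (p %| k)%N -> D f ->
    cong (p ^ logn p k) (theta k f) (fun v => theta (k %/ p)%N f (F p v)).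
  move=> pp k0 pk Df; apply: cong_ext (cong_refl _ (theta k f)) => v //.
  congr (f _); apply: functional_extensionality => x.
  by rewrite /F psivM mulnC divnK.
pose X b n v := wphi m theta (fun d v => v (b, 1%N, d)) n v.
have DX b n : D (X b n) by apply: D_wphi => // d; exact: D_var.
have dX b : dwork m F (X b) by apply: wphi_dwork => // d; exact: D_var.
have [|a [Da aE]] := dwork_exists DF Dth th1 thF _
  (dworkZ (1 - m) (dworkM DF (fun n _ => DX true n) (fun n _ => DX false n) (dX true) (dX false))).
  by move=> n _; apply: D_mul; [exact: D_const | exact: D_mul].
have [P PE] := D_zexprs Da; exists P => A v n n0.
pose f (A : comPzRingType) (v : V -> A) :=
  \dsum_(d | n) (wc m n d)%:~R * zeval v (zrename (psiv (n %/ d)%N) (P d)).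
pose h b (A : comPzRingType) (v : V -> A) :=
  \dsum_(d | n) (wc m n d)%:~R * v (b, (n %/ d)%N, d).
pose g (A : comPzRingType) (v : V -> A) := (1 - m)%:~R * h true A v * h false A v.
apply: (@pfun_int_eq _ f g) => [||w].
- by apply: (pfun_dsum n (wc m n)) => d; exact: pfun_expr.
- have ph b : pfun (h b) by apply: (pfun_dsum n (wc m n)) => d; exact: pfun_var.
  by apply: pfunM => //; apply: pfunM => //; exact: pfun_const.
transitivity (wphi m theta a n w).
  by apply: eq_bigr => d _; rewrite intz zeval_rename PE.
have XE b : X b n w = h b int w.
  by apply: eq_bigr => d _; rewrite intz /theta /F /psiv muln1.
by rewrite aE // !XE /g intz -mulrA.
Qed.

Definition psi_val k (v : nat -> int) (j : nat) : int := psi_seq k (cons1 v) j.+1.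

Lemma psi_val_lift : frobenius_lift psi_val.
Proof.
split=> [p x|p x pp]; last exact: psi_seq_cong.
apply: (@D_psi_seq nat (fun n v => cons1 v n)) => n.
by apply: D_cons1 => j; exact: D_var.
Qed.

(** The criterion is used with two choices of theta: [n]_m x^n satisfies it as a sum with powers,
    and is then expanded as a sum with psi^k. Both refer to the same substitutions [psi_val p],
    which lift Frobenius. *)
Lemma M_exists_int m : exists M : nat -> zexpr nat, forall (v : nat -> int) n, (0 < n)%N ->
  \dsum_(d | n) wc m n d * zeval (psi_val (n %/ d) v) (M d) = qint m n * v 0%N ^+ n.
Proof.
pose theta k (f : (nat -> int) -> int) v := f (psi_val k v).
have DF := proj1 psi_val_lift.
have Dth k f : D f -> D (theta k f) by apply: D_comp => x; exact: DF.
have th1 f v : D f -> theta 1%N f v = f v.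
  move=> _; congr (f _); apply: functional_extensionality => x.
  by rewrite /psi_val psi_seq1.
have thF p k f : prime p -> (0 < k)%N -> (p %| k)%N -> D f ->
    cong (p ^ logn p k) (theta k f) (fun v => theta (k %/ p)%N f (psi_val p v)).
  move=> pp k0 pk Df; apply: cong_ext (cong_refl _ (theta k f)) => v //.
  congr (f _); apply: functional_extensionality => x; rewrite /psi_val.
  have kp0 := dvdn_div_gt0 k0 pk; have p0 := prime_gt0 pp.
  by rewrite -[in LHS](divnK pk) -psi_seqM //; apply: eq_psi_seq.
(* For the Witt vector (x, 0, 0, ...) only d = 1 contributes, with the term [n]_m x^n. *)
pose a d (v : nat -> int) : int := if d == 1%N then v 0%N else 0.
have Da d : D (a d) by rewrite /a; case: eqP => _; [exact: D_var | exact: D_const].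
have dg : dwork m psi_val (fun n v => qint m n * v 0%N ^+ n).
  apply: eq_dwork (power_dwork m psi_val_lift Da) => n v n0.
  rewrite /wphi big_ltn_cond // dvd1n divn1 big_nat_cond big1 => [|d /andP[/andP[d1 dn] dvn]].
    by rewrite addr0 /wc divn1 mul1r.
  rewrite /fexp /a gtn_eqF // expr0n eqn0Ngt dvdn_div_gt0 ?mulr0 //.
have [|b [Db bE]] := dwork_exists DF Dth th1 thF _ dg.
  move=> n n0; apply: D_mul; first exact: D_const.
  by apply: D_exp; exact: D_var.
have [M ME] := D_zexprs Db; exists M => v n n0; rewrite -bE //.
by apply: eq_bigr => d _; rewrite ME.
Qed.

Lemma esymF_1 (I : finType) (z : I -> int) : esymF z 1 = \sum_i z i.
Proof. by rewrite -nu1 nu_esymF. Qed.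

(** The second property, for arbitrary E, is the one used later; the first allows it to be carried
    over to the chosen [M_poly]. *)
Lemma M_exists m : exists M, M_spec m M /\ forall (E : nat -> int) n, E 0%N = 1 -> (0 < n)%N ->
  \dsum_(d | n) wc m n d * zeval (psi_seq (n %/ d) E) (M d) = qint m n * E 1%N ^+ n.
Proof.
have [M' M'E] := M_exists_int m; pose M d := zrename S (M' d).
have ME (E : nat -> int) n : E 0%N = 1 -> (0 < n)%N ->
    \dsum_(d | n) wc m n d * zeval (psi_seq (n %/ d) E) (M d) = qint m n * E 1%N ^+ n.
  move=> E0 n0; rewrite -(M'E (fun j => E j.+1)) //; apply: eq_bigr => d dn.
  by rewrite zeval_rename.
exists M; split=> // K A y n n0.
pose f (A : comPzRingType) (y : 'I_K -> A) := \dsum_(d | n)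
  (wc m n d)%:~R * zeval (fun i => esymF (fun l => y l ^+ (n %/ d)) i) (M d).
pose g (A : comPzRingType) (y : 'I_K -> A) := (qint m n)%:~R * (\sum_(l < K) y l) ^+ n.
apply: (@pfun_int_eq _ f g) => [||w].
- apply: (pfun_dsum n (wc m n)) => d; apply: pfun_zeval => i.
  apply: (@pfun_esymF _ _ (fun l A y => y l ^+ (n %/ d))) => l.
  by apply: pfunX; exact: pfun_var.
- apply: pfunM; first exact: pfun_const.
  apply: pfunX; apply: (@pfun_sum _ _ (index_enum 'I_K) xpredT (fun l A y => y l)) => l _.
  exact: pfun_var.
rewrite /f /g intz -esymF_1 -ME ?esymF0 //; apply: eq_bigr => d dn.
rewrite intz; congr (_ * _); apply: eq_zeval => i.
by rewrite psi_seq_esymF // dvdn_div_gt0.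
Qed.

(** * Uniqueness of M and properties of the chosen polynomials *)

Lemma vieta (K : nat) (c : nat -> algC) : c 0%N = 1 ->
  exists y : 'I_K -> algC, forall i, (i <= K)%N -> esymF y i = c i.
Proof.
move=> c0; pose p : {poly algC} := \poly_(i < K.+1) ((-1) ^+ (K - i) * c (K - i)%N).
have lp : p`_K = 1 by rewrite coef_poly ltnSn subnn expr0 c0 mulr1.
have sp : size p = K.+1 by rewrite size_poly_eq // subnn expr0 c0 mulr1 oner_neq0.
have [r pE] := closed_field_poly_normal p.
have lcp : lead_coef p = 1 by rewrite lead_coefE sp.
rewrite lcp scale1r in pE.
have sr : size r = K by apply: succn_inj; rewrite -sp pE size_prod_XsubC.
exists (fun i => r`_i) => i iK.
have pE' : p = \prod_(j < K) ('X + (-1) * (r`_j)%:P).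
  rewrite pE (big_nth 0) sr big_mkord; apply: eq_bigr => j _.
  by rewrite mulN1r.
have eC k : esymF (fun j : 'I_K => (r`_j)%:P) k = (esymF (fun j : 'I_K => r`_j) k)%:P.
  by rewrite /esymF rmorph_sum; apply: eq_bigr => S _; rewrite rmorph_prod.
have tE k : 'X ^+ (K - k) * (-1) ^+ k * esymF (fun j : 'I_K => (r`_j)%:P) k =
    ((-1) ^+ k * esymF (fun j : 'I_K => r`_j) k)%:P * 'X^(K - k) :> {poly algC}.
  by rewrite eC polyCM polyC_exp polyCN polyC1; ring.
have := congr1 (fun q : {poly algC} => q`_(K - i)) pE'.
rewrite /= (prod_add_esymF 'X (-1) (fun j : 'I_K => (r`_j)%:P)) coef_sum card_ord.
rewrite coef_poly ltnS leq_subr subKn // (bigD1 (inord i)) //= inordK // big1 => [|k].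
  rewrite addr0 tE coefCM coefXn eqxx mulr1 => /mulfI -> //.
  by rewrite signr_eq0.
rewrite -val_eqE /= inordK // => ki; rewrite tE coefCM coefXn.
by case: eqP => [Kik|_]; rewrite ?mulr0 //; have := ltn_ord k; lia.
Qed.

(* Algebraic independence of the elementary symmetric functions: any integers E_1, ..., E_K are
   their values at the roots of a monic polynomial. *)
Lemma esym_independent (p q : zexpr nat) :
  (forall K (y : 'I_K -> algC), zeval (esymF y) p = zeval (esymF y) q) ->
  forall E : nat -> int, E 0%N = 1 -> zeval E p = zeval E q.
Proof.
move=> pq E E0; pose K := \max_(i <- zvars p ++ zvars q) i.
have [|y yE] := @vieta K (fun i => (E i)%:~R); first by rewrite E0.
have yK i : i \in zvars p ++ zvars q -> (E i)%:~R = esymF y i.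
  by move=> ipq; rewrite yE //; exact: (@leq_bigmax_seq _ _ xpredT (fun i : nat => i) i ipq).
have ev r : {subset zvars r <= zvars p ++ zvars q} ->
    zeval (fun i => (E i)%:~R : algC) r = zeval (esymF y) r.
  by move=> sr; apply: eq_in_zeval => i /sr /yK.
apply: (@intr_inj algC); rewrite !rmorph_zeval (ev p) ?(ev q) ?pq // => i ir.
  by rewrite mem_cat ir orbT.
by rewrite mem_cat ir.
Qed.

(** The term d = n is n times M(n) at y, and n cancels in [algC]. The other terms are evaluated at
    the powers y_l^(n/d), which the induction covers since y is arbitrary. *)
Lemma M_spec_unique m (M N : nat -> zexpr nat) : M_spec m M -> M_spec m N ->
  forall n, (0 < n)%N -> forall K (y : 'I_K -> algC),
    zeval (esymF y) (M n) = zeval (esymF y) (N n).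
Proof.
move=> MP NP n; elim/ltn_ind: n => n IHn n0 K y.
have ME (L : nat -> zexpr nat) : M_spec m L -> n%:R * zeval (esymF y) (L n) =
    (qint m n)%:~R * (\sum_(l < K) y l) ^+ n - \sum_(1 <= d < n | (d %| n)%N)
      (wc m n d)%:~R * zeval (esymF (fun l => y l ^+ (n %/ d))) (L d).
  move=> LP; rewrite -(LP K _ y n n0) dsum_recr // wc_id // divnn n0 addrC addKr.
  by congr (_ * _); apply: eq_zeval => i; apply: eq_esymF => l; rewrite expr1.
have n0' : n%:R != 0 :> algC by rewrite pnatr_eq0 -lt0n.
apply: (mulfI n0'); rewrite (ME M) // (ME N) //; congr (_ - _).
rewrite big_nat_cond [RHS]big_nat_cond; apply: eq_bigr => d /andP[/andP[d0 dn] _].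
by rewrite IHn.
Qed.

Lemma WS_polyP m : WS_spec m (WS_poly m).
Proof. by rewrite /WS_poly; apply: epsilon_spec; exact: WS_exists. Qed.

Lemma WP_polyP m : WP_spec m (WP_poly m).
Proof. by rewrite /WP_poly; apply: epsilon_spec; exact: WP_exists. Qed.

Lemma BP_polyP m : BP_spec m (BP_poly m).
Proof. by rewrite /BP_poly; apply: epsilon_spec; exact: BP_exists. Qed.

Lemma M_poly_int m (E : nat -> int) n : E 0%N = 1 -> (0 < n)%N ->
  \dsum_(d | n) wc m n d * zeval (psi_seq (n %/ d) E) (M_poly m d) = qint m n * E 1%N ^+ n.
Proof.
move=> E0 n0; have [M [MS ME]] := M_exists m; rewrite -ME //.
have MP : M_spec m (M_poly m) by rewrite /M_poly; apply: epsilon_spec; exists M.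
rewrite big_nat_cond [RHS]big_nat_cond; apply: eq_bigr => d /andP[/andP[d0 _] dn].
congr (_ * _); apply: esym_independent; last by rewrite psi_seq0 ?dvdn_div_gt0.
exact: (M_spec_unique MP MS d0).
Qed.

Lemma M_poly1 m (E : nat -> int) : E 0%N = 1 -> zeval E (M_poly m 1) = E 1%N.
Proof.
move=> E0; have := @M_poly_int m E 1 E0 isT.
rewrite dsum_recr // big_geq // add0r wc_id // mul1r qint1 mul1r expr1 => <-.
by apply: eq_zeval => i; rewrite psi_seq1.
Qed.

(** * The isomorphism tau *)

Lemma dsum_dsum (R : nmodType) n (G : nat -> nat -> R) : (0 < n)%N ->
  \dsum_(d | n) \dsum_(e | d) G d e = \dsum_(e | n) \dsum_(c | n %/ e) G (e * c)%N e.
Proof.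
move=> n0.
transitivity (\dsum_(d | n) \sum_(1 <= e < n.+1 | (e %| d)%N) G d e).
  rewrite big_nat_cond [RHS]big_nat_cond; apply: eq_bigr => d /andP[/andP[d0 dn] _].
  by apply: dsum_widen; rewrite d0.
rewrite (exchange_big_dep (fun e => (e %| n)%N)) /=; last by move=> d e dn ed; apply: dvdn_trans ed dn.
rewrite big_nat_cond [RHS]big_nat_cond; apply: eq_bigr => e /andP[/andP[e0 _] en].
rewrite -big_filter -[RHS]big_filter -(big_map (muln e) xpredT (fun d => G d e)).
apply: perm_big; apply: uniq_perm; first by rewrite filter_uniq ?iota_uniq.
  rewrite map_inj_uniq ?filter_uniq ?iota_uniq // => c c' /eqP.
  by rewrite eqn_pmul2l // => /eqP.
have ne0 := dvdn_div_gt0 n0 en.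
move=> d; apply/idP/mapP => [|[c]].
  rewrite mem_filter mem_index_iota => /andP[/andP[dn /dvdnP[c dE]] /andP[d0 _]].
  rewrite {d}dE in dn d0 *; exists c; last exact: mulnC.
  have cn : (c %| n %/ e)%N by rewrite dvdn_divRL.
  rewrite mem_filter cn mem_index_iota ltnS (dvdn_leq ne0 cn) andbT.
  by move: d0; rewrite muln_gt0 => /andP[].
rewrite mem_filter mem_index_iota => /andP[cn /andP[c0 _]] ->.
have ecn : (e * c %| n)%N by rewrite mulnC -dvdn_divRL.
by rewrite mem_filter ecn dvdn_mulr // mem_index_iota muln_gt0 e0 c0 ltnS (dvdn_leq n0 ecn).
Qed.

(** A component of [tau] with the lambda^i(a_d) replaced by free entries [E d i], so that it makes
    sense over Z. *)
Definition Tsum m (A : comPzRingType) (E : nat -> nat -> A) n : A :=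
  \dsum_(d | n) zeval (E d) (M_poly m (n %/ d)).

Lemma eq_Tsum m (A : comPzRingType) (E E' : nat -> nat -> A) n :
  (forall d i, (0 < d)%N -> E d i = E' d i) -> Tsum m E n = Tsum m E' n.
Proof.
move=> EE; rewrite /Tsum big_nat_cond [RHS]big_nat_cond.
by apply: eq_bigr => d /andP[/andP[d0 _] _]; apply: eq_zeval => i; rewrite EE.
Qed.

Lemma pfun_Tsum m (V : Type) (E : nat -> nat -> forall A : comPzRingType, (V -> A) -> A) n :
  (forall d i, pfun (E d i)) -> pfun (fun A v => Tsum m (fun d i => E d i A v) n).
Proof.
move=> pE; apply: (@pfun_sum V _ (index_iota 1 n.+1) (fun d => (d %| n)%N)
  (fun d A v => zeval (fun i => E d i A v) (M_poly m (n %/ d)))) => d _.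
exact: pfun_zeval.
Qed.

(* The ghost component of tau: exchanging the two divisor sums leaves, for each e, the identity
   that defines M at E_e. *)
Lemma Tsum_key m (E : nat -> nat -> int) n : (forall e, E e 0%N = 1) -> (0 < n)%N ->
  \dsum_(d | n) wc m n d * Tsum m (fun e => psi_seq (n %/ d) (E e)) d =
  \dsum_(e | n) wc m n e * E e 1%N ^+ (n %/ e).
Proof.
move=> E0 n0; under eq_bigr => d _ do rewrite /Tsum mulr_sumr.
rewrite (dsum_dsum (fun d e => wc m n d * zeval (psi_seq (n %/ d) (E e)) (M_poly m (d %/ e)))) //.
rewrite big_nat_cond [RHS]big_nat_cond; apply: eq_bigr => e /andP[/andP[e0 _] en].
rewrite {2}/wc -mulrA -(M_poly_int m (E0 e) (dvdn_div_gt0 n0 en)) mulr_sumr.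
apply: eq_bigr => c cn; rewrite mulKn // -divnMA /wc PoszM -divnMA; ring.
Qed.

(** psi^k is a ring endomorphism of Lambda(Z): on power sums it only shifts the index from l to l
    k. *)
Lemma lam_eval_psi (V : Type) (E : V -> nat -> int) p k i : (forall x, E x 0%N = 1) ->
  (0 < k)%N -> psi_seq k (lam_eval E p) i = lam_eval (fun x => psi_seq k (E x)) p i.
Proof.
move=> E0 k0; have [_ nuE] := lam_eval_spec p E0.
have [pE0 nuE'] := @lam_eval_spec _ (fun x => psi_seq k (E x)) p (fun x => psi_seq0 _ k0).
apply: (@nu_inj _ _ i) => // [|l /andP[l0 _]]; first by rewrite psi_seq0 // pE0.
rewrite nu_psi_seq // nuE ?muln_gt0 ?l0 // nuE' //.
by apply: eq_zeval => x; rewrite nu_psi_seq.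
Qed.

Lemma lam_eval1 (V : Type) (E : V -> nat -> int) p : (forall x, E x 0%N = 1) ->
  lam_eval E p 1 = zeval (fun x => E x 1%N) p.
Proof.
move=> E0; have [_ nuE] := lam_eval_spec p E0.
by rewrite -nu1 nuE //; apply: eq_zeval => x; rewrite nu1.
Qed.

(** Moving psi^(n/d) inside [lam_eval] gives the terms d < n the shape of the claims below, with the
    sequences [psi_seq (n %/ d) (E x)] in place of [E x]. *)
Lemma Tsum_lam_eval_key m (E : bool * nat -> nat -> int) (S : nat -> zexpr (bool * nat)) n :
  (forall x, E x 0%N = 1) -> (0 < n)%N ->
  n%:Z * Tsum m (fun d => lam_eval E (S d)) n +
  \sum_(1 <= d < n | (d %| n)%N)
     wc m n d * Tsum m (fun e => lam_eval (fun x => psi_seq (n %/ d) (E x)) (S e)) d =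
  \dsum_(e | n) wc m n e * zeval (fun x => E x 1%N) (S e) ^+ (n %/ e).
Proof.
move=> E0 n0; have SE0 d : lam_eval E (S d) 0 = 1 by have [] := lam_eval_spec (S d) E0.
transitivity (\dsum_(e | n) wc m n e * lam_eval E (S e) 1 ^+ (n %/ e)); last first.
  by apply: eq_bigr => e _; rewrite lam_eval1.
rewrite -(@Tsum_key m (fun d => lam_eval E (S d)) n SE0 n0) [RHS]dsum_recr // addrC wc_id //; congr (_ + _ * _).
  rewrite big_nat_cond [RHS]big_nat_cond; apply: eq_bigr => d /andP[_ dn].
  congr (_ * _); apply: eq_Tsum => e i _; rewrite lam_eval_psi //; exact: dvdn_div_gt0.
by apply: eq_Tsum => e i _; rewrite divnn n0 psi_seq1.
Qed.

Lemma Tsum_split m (E : nat -> nat -> int) n : (forall e, E e 0%N = 1) -> (0 < n)%N ->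
  n%:Z * Tsum m E n + \sum_(1 <= d < n | (d %| n)%N)
     wc m n d * Tsum m (fun e => psi_seq (n %/ d) (E e)) d =
  \dsum_(e | n) wc m n e * E e 1%N ^+ (n %/ e).
Proof.
move=> E0 n0; rewrite -(Tsum_key m E0) // [RHS]dsum_recr // addrC wc_id //; congr (_ + _ * _).
by apply: eq_Tsum => e i _; rewrite divnn n0 psi_seq1.
Qed.

Lemma Tsum_WS m n (E : bool * nat -> nat -> int) : (forall x, E x 0%N = 1) -> (0 < n)%N ->
  Tsum m (fun d => lam_eval E (WS_poly m d)) n =
  Tsum m (fun d => E (true, d)) n + Tsum m (fun d => E (false, d)) n.
Proof.
elim/ltn_ind: n E => n IHn E E0 n0.
have nz : n%:Z != 0 by rewrite eqz_nat -lt0n.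
apply: (mulfI nz); have := Tsum_lam_eval_key m (WS_poly m) E0 n0.
have := @WS_polyP m int (fun x => E x 1%N) n n0.
under eq_bigr do rewrite intz.
move=> -> H; apply: (addIr (\sum_(1 <= d < n | (d %| n)%N)
   wc m n d * Tsum m (fun e => lam_eval (fun x => psi_seq (n %/ d) (E x)) (WS_poly m e)) d)).
rewrite H {H}; have Eb b d : E (b, d) 0%N = 1 by [].
have -> : \sum_(1 <= d < n | (d %| n)%N)
   wc m n d * Tsum m (fun e => lam_eval (fun x => psi_seq (n %/ d) (E x)) (WS_poly m e)) d =
   \sum_(1 <= d < n | (d %| n)%N)
     wc m n d * Tsum m (fun e => psi_seq (n %/ d) (E (true, e))) d +
   \sum_(1 <= d < n | (d %| n)%N)
     wc m n d * Tsum m (fun e => psi_seq (n %/ d) (E (false, e))) d.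
  rewrite -big_split [LHS]big_nat_cond [RHS]big_nat_cond /=.
  apply: eq_bigr => d /andP[/andP[d0 dn] dvdn]; rewrite IHn // ?mulrDr // => x.
  by rewrite psi_seq0 // dvdn_div_gt0.
rewrite mulrDr addrACA (Tsum_split m (Eb true)) // (Tsum_split m (Eb false)) // -big_split.
by apply: eq_bigr => d _; rewrite intz mulrDr.
Qed.

(* Value at [Psi^k x_d] (resp. [Psi^k y_d]) when [x], [y] are the images under tau of two
   sequences with lambda-operations [E (true, _)], [E (false, _)]. The index [k = 0] never
   carries information: [adams] is 0 there and [psiv] fixes it. *)
Definition Tval m (A : comPzRingType) (E : bool * nat -> nat -> A) (x : bool * nat * nat) : A :=
  if x.1.2 == 0%N then 0 else Tsum m (fun e => psi_seq x.1.2 (E (x.1.1, e))) x.2.-1.+1.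

Lemma Tsum_WP m n (E : bool * nat -> nat -> int) : (forall x, E x 0%N = 1) -> (0 < n)%N ->
  Tsum m (fun d => lam_eval E (WP_poly m d)) n = zeval (Tval m E) (BP_poly m n).
Proof.
elim/ltn_ind: n E => n IHn E E0 n0; have Eb b d : E (b, d) 0%N = 1 by [].
have nz : n%:Z != 0 by rewrite eqz_nat -lt0n.
apply: (mulfI nz); have := Tsum_lam_eval_key m (WP_poly m) E0 n0.
have := @WP_polyP m int (fun x => E x 1%N) n n0.
under eq_bigr do rewrite intz; move=> ->.
(* Each factor of the product in W^m is rewritten as the corresponding factor in B^m, so that
   [BP_spec] applies to the right-hand side. *)
have keyb b : \dsum_(d | n) (wc m n d)%:~R * E (b, d) 1%N ^+ (n %/ d) =
    \dsum_(d | n) (wc m n d)%:~R * Tval m E (b, (n %/ d)%N, d).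
  under eq_bigr do rewrite intz.
  rewrite -(@Tsum_key m (fun d => E (b, d)) n (Eb b) n0) big_nat_cond [RHS]big_nat_cond.
  apply: eq_bigr => d /andP[/andP[d0 _] dn].
  by rewrite intz /Tval /= eqn0Ngt dvdn_div_gt0 //= prednK.
rewrite (keyb true) (keyb false) -(@BP_polyP m int (Tval m E) n n0) => H.
apply: (addIr (\sum_(1 <= d < n | (d %| n)%N)
   wc m n d * Tsum m (fun e => lam_eval (fun x => psi_seq (n %/ d) (E x)) (WP_poly m e)) d)).
rewrite H {H} dsum_recr // addrC intz wc_id // divnn n0 zeval_rename; congr (_ * _ + _).
  by apply: eq_zeval => x; rewrite psivK1.
rewrite big_nat_cond [RHS]big_nat_cond; apply: eq_bigr => d /andP[/andP[d0 dn] dvdn].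
have nd0 := dvdn_div_gt0 n0 dvdn.
rewrite IHn // => [|x]; last by rewrite psi_seq0.
rewrite intz zeval_rename; congr (_ * _); apply: eq_zeval => -[[b k] e].
rewrite /Tval /psiv /= muln_eq0 eqn0Ngt nd0 /=; case: (posnP k) => // k0.
by apply: eq_Tsum => l i _; rewrite psi_seqM // mulnC.
Qed.

Section Tau.
Variables (m : int) (R : comPzRingType) (lam : nat -> R -> R).
Hypothesis lamP : is_lambda_ring lam.
Implicit Types a b : nat -> R.

Lemma tauE a k : tau m lam a k = Tsum m (fun d i => lam i (a d.-1)) k.+1.
Proof. by []. Qed.

Lemma cons1_lam r i : cons1 (fun j => lam j.+1 r) i = lam i r.
Proof. by case: i => //=; rewrite lam0. Qed.

Lemma Mval1 r : Mval m lam r 1 = r.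
Proof.
pose f (A : comPzRingType) (v : nat -> A) := zeval (cons1 v) (M_poly m 1).
pose g (A : comPzRingType) (v : nat -> A) := v 0%N.
transitivity (f R (fun j => lam j.+1 r)).
  by apply: eq_zeval => i; rewrite cons1_lam.
transitivity (g R (fun j => lam j.+1 r)); last exact: (lam1 lamP).
apply: (@pfun_int_eq _ f g) => [||v].
- by apply: pfun_zeval => i; exact: (@pfun_cons1 _ id).
- exact: pfun_var.
- exact: M_poly1.
Qed.

Lemma tau_recr a k : tau m lam a k =
  \sum_(1 <= d < k.+1 | (d %| k.+1)%N) Mval m lam (a d.-1) (k.+1 %/ d) + a k.
Proof. by rewrite /tau dsum_recr // divnn Mval1. Qed.

Lemma tau_bij : bijective (tau m lam).
Proof.
have surj b : exists a, tau m lam a = b.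
  pose P n (a : nat -> R) t :=
    t = b n - \sum_(1 <= d < n.+1 | (d %| n.+1)%N) Mval m lam (a d.-1) (n.+1 %/ d).
  have [|n a _|a aP] := @strong_choice R 0 P; last first.
  - exists a; apply: functional_extensionality => n.
    by rewrite tau_recr aP addrC subrK.
  - by eexists.
  move=> n a c t ac ->; congr (_ - _); rewrite big_nat_cond [RHS]big_nat_cond.
  by apply: eq_bigr => d /andP[/andP[d0 dn] _]; rewrite ac // prednK.
have inj : injective (tau m lam).
  move=> a c ac; apply: functional_extensionality => n; elim/ltn_ind: n => n IHn.
  have := congr1 (fun t => t n) ac; rewrite /= !tau_recr.
  have -> : \sum_(1 <= d < n.+1 | (d %| n.+1)%N) Mval m lam (a d.-1) (n.+1 %/ d) =
            \sum_(1 <= d < n.+1 | (d %| n.+1)%N) Mval m lam (c d.-1) (n.+1 %/ d).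
    rewrite big_nat_cond [RHS]big_nat_cond.
    by apply: eq_bigr => d /andP[/andP[d0 dn] _]; rewrite IHn // prednK.
  exact: addrI.
pose g b := proj1_sig (constructive_indefinite_description _ (surj b)).
have gK : cancel g (tau m lam).
  by move=> b; rewrite /g; case: constructive_indefinite_description.
by exists g => // a; apply: inj; rewrite gK.
Qed.

Lemma adams_pfun (V : eqType) (f : forall A : comPzRingType, (V -> A) -> A) (v : V -> R) k :
  pfun f -> (0 < k)%N -> adams lam k (f R v) = f R (fun x => adams lam k (v x)).
Proof. by move=> [p pE] k0; rewrite !pE adams_zeval. Qed.

(** Each component of [tau] is an integer polynomial in the lambda^i(a_e), through which the ring
    endomorphism psi^j passes. *)
Lemma adams_tau a j d : (0 < j)%N ->
  adams lam j (tau m lam a d) = Tsum m (fun e => psi_seq j (lam^~ (a e.-1))) d.+1.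
Proof.
move=> j0; pose f (A : comPzRingType) (v : nat * nat -> A) := Tsum m (fun e i => v (e, i)) d.+1.
rewrite tauE -[Tsum _ _ _]/(f R (fun x => lam x.2 (a x.1.-1))) adams_pfun //; last first.
  by apply: (@pfun_Tsum _ _ (fun e i A v => v (e, i))) => e i; exact: pfun_var.
by apply: eq_Tsum => e i _; rewrite adams_lam.
Qed.

Lemma Tsum_key_lambda a n : (0 < n)%N ->
  \dsum_(d | n) (wc m n d)%:~R * Tsum m (fun e => psi_seq (n %/ d) (lam^~ (a e.-1))) d =
  \dsum_(e | n) (wc m n e)%:~R * a e.-1 ^+ (n %/ e).
Proof.
move=> n0; pose E e i (A : comPzRingType) (v : nat * nat -> A) := cons1 (fun j => v (e, j)) i.
have pE e i : pfun (E e i) by exact: pfun_cons1.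
pose f (A : comPzRingType) (v : nat * nat -> A) := \dsum_(d | n) (wc m n d)%:~R *
  Tsum m (fun e => psi_seq (n %/ d) (fun i => E e i A v)) d.
pose g (A : comPzRingType) (v : nat * nat -> A) :=
  \dsum_(e | n) (wc m n e)%:~R * v (e, 0%N) ^+ (n %/ e).
pose w x := lam x.2.+1 (a x.1.-1).
transitivity (f R w); first by [].
transitivity (g R w); last by apply: eq_bigr => e _; rewrite /w lam1.
apply: (@pfun_int_eq _ f g) => [||v].
- apply: (pfun_dsum n (wc m n)) => d.
  apply: (@pfun_Tsum m _ (fun e i A v => psi_seq (n %/ d) (fun j => E e j A v) i)) => e i.
  exact: pfun_psi_seq.
- by apply: (pfun_dsum n (wc m n)) => d; apply: pfunX; exact: pfun_var.
rewrite /f /g; under eq_bigr do rewrite intz; under [RHS]eq_bigr do rewrite intz.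
exact: (@Tsum_key m (fun e i => E e i int v)).
Qed.

(** Since d (1 - m^(n/d)) = (1 - m) d [n/d]_m, both maps are 1 - m times the sums compared in
    [Tsum_key_lambda]. *)
Lemma PhiW_phiB a : PhiW m a = phiB m lam (tau m lam a).
Proof.
apply: functional_extensionality => k.
have wcE d : (d%:Z * (1 - m ^+ (k.+1 %/ d)))%:~R = (1 - m)%:~R * (wc m k.+1 d)%:~R :> R.
  by rewrite -wcM1 rmorphM.
rewrite /PhiW /phiB; under eq_bigr do rewrite wcE -mulrA.
under [RHS]eq_bigr do rewrite wcE -mulrA.
rewrite -!mulr_sumr -Tsum_key_lambda //; congr (_ * _).
rewrite big_nat_cond [RHS]big_nat_cond; apply: eq_bigr => d /andP[/andP[d0 _] dk].
by rewrite adams_tau ?dvdn_div_gt0 // prednK.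
Qed.

Let lam2 a b (x : bool * nat) : nat -> R := lam^~ (if x.1 then a x.2.-1 else b x.2.-1).

Lemma tau_zeval a b (S : nat -> zexpr (bool * nat)) k :
  tau m lam (fun j => zeval (fun v => if v.1 then a v.2.-1 else b v.2.-1) (S j.+1)) k =
  Tsum m (fun d => lam_eval (lam2 a b) (S d)) k.+1.
Proof.
by rewrite tauE; apply: eq_Tsum => d i d0; rewrite lam_zeval // prednK.
Qed.

Let univ (A : comPzRingType) (v : bool * nat * nat -> A) (x : bool * nat) (i : nat) : A :=
  cons1 (fun j => v (x, j)) i.

Lemma lam2E a b : lam2 a b = univ (fun x => lam x.2.+1 (if x.1.1 then a x.1.2.-1 else b x.1.2.-1)).
Proof.
apply: functional_extensionality => x; apply: functional_extensionality => i.
by rewrite /univ /= cons1_lam.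
Qed.

Lemma pfun_univ x i : pfun (fun A v => @univ A v x i).
Proof. exact: pfun_cons1. Qed.

Lemma tau_add a b : tau m lam (Wadd m a b) = Badd (tau m lam a) (tau m lam b).
Proof.
apply: functional_extensionality => k; rewrite tau_zeval /Badd !tauE.
pose f (A : comPzRingType) v := Tsum m (fun d => lam_eval (@univ A v) (WS_poly m d)) k.+1.
pose g (A : comPzRingType) v := Tsum m (fun d => @univ A v (true, d)) k.+1 +
  Tsum m (fun d => @univ A v (false, d)) k.+1.
rewrite -[RHS]/(Tsum m (fun d => lam2 a b (true, d)) k.+1 +
  Tsum m (fun d => lam2 a b (false, d)) k.+1) lam2E.
apply: (@pfun_int_eq _ f g) => [||v].
- apply: (@pfun_Tsum m _ (fun d i A v => lam_eval (@univ A v) (WS_poly m d) i)) => d i.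
  by apply: (@pfun_lam_eval _ _ (fun x i A v => @univ A v x i)) => x j; exact: pfun_univ.
- apply: pfunD.
    by apply: (@pfun_Tsum m _ (fun d i A v => @univ A v (true, d) i)) => d i; exact: pfun_univ.
  by apply: (@pfun_Tsum m _ (fun d i A v => @univ A v (false, d) i)) => d i; exact: pfun_univ.
exact: Tsum_WS.
Qed.

Lemma tau_mul a b : tau m lam (Wmul m a b) = Bmul m lam (tau m lam a) (tau m lam b).
Proof.
apply: functional_extensionality => k; rewrite tau_zeval /Bmul.
pose f (A : comPzRingType) v := Tsum m (fun d => lam_eval (@univ A v) (WP_poly m d)) k.+1.
pose g (A : comPzRingType) v := zeval (Tval m (@univ A v)) (BP_poly m k.+1).
transitivity (zeval (Tval m (lam2 a b)) (BP_poly m k.+1)); last first.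
  (* At j = 0 both values are 0 by default. At d = 0 both read the first component, which accounts
     for [.-1.+1] in [Tval]. *)
  apply: eq_zeval => -[[b' j] d]; rewrite /Tval /=; case: (posnP j) => [-> //|j0].
  by case: b'; rewrite adams_tau.
rewrite lam2E; apply: (@pfun_int_eq _ f g) => [||v].
- apply: (@pfun_Tsum m _ (fun d i A v => lam_eval (@univ A v) (WP_poly m d) i)) => d i.
  by apply: (@pfun_lam_eval _ _ (fun x i A v => @univ A v x i)) => x j; exact: pfun_univ.
- apply: pfun_zeval => x; rewrite /Tval; case: (posnP x.1.2) => [_|_]; first exact: pfun0.
  apply: (@pfun_Tsum m _ (fun e i A v => psi_seq x.1.2 (@univ A v (x.1.1, e)) i)) => e i.
  by apply: (@pfun_psi_seq _ (fun i A v => @univ A v (x.1.1, e) i)) => j; exact: pfun_univ.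
exact: Tsum_WP.
Qed.

End Tau.

Theorem theorem7p11 (m : int) :
  (forall (R : comPzRingType) (lam : nat -> R -> R), is_lambda_ring lam ->
     [/\ bijective (tau m lam),
         (forall a b : nat -> R, tau m lam (Wadd m a b) = Badd (tau m lam a) (tau m lam b)),
         (forall a b : nat -> R, tau m lam (Wmul m a b) = Bmul m lam (tau m lam a) (tau m lam b)) &
         (forall a : nat -> R, PhiW m a = phiB m lam (tau m lam a))])
  /\
  (forall (R S : comPzRingType) (lamR : nat -> R -> R) (lamS : nat -> S -> S),
     is_lambda_ring lamR -> is_lambda_ring lamS ->
     forall f : {rmorphism R -> S}, is_lambda_hom lamR lamS f ->
     forall a : nat -> R, tau m lamS (f \o a) = f \o tau m lamR a).
Proof.
split=> [R lam lamP|R S lamR lamS _ _ f flam a].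
  split; [exact: tau_bij | exact: tau_add | exact: tau_mul | exact: PhiW_phiB].
apply: functional_extensionality => k; rewrite /tau /= rmorph_sum.
apply: eq_bigr => d _; rewrite /Mval rmorph_zeval.
by apply: eq_zeval => i; rewrite flam.
Qed.
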